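(* Let $N\ge 2$, $\beta=0$, $\alpha,\gamma,\mu>0$ and $T=\infty$ (no closing time). Then a symmetric equilibrium arrival distribution $F$ of the $(N+1)$-customer game satisfies the following properties. If arriving before time zero is allowed (any $t\in\mathbb{R}$ is an admissible arrival time), then: (1) The support of the equilibrium arrival distribution is an infinite interval $[t_a,\infty)$, where $t_a<0$. (2) The expected cost of every customer in equilibrium is $N\gamma$. (3) The first possible arrival is at $t_a=-N\frac{\gamma}{\alpha}$. If arriving before time zero is not allowed (only $t\ge 0$ is admissible), then: (4) There is a positive probability $p_0$ to arrive at time zero, given by $$p_0=\begin{cases}\dfrac{2\gamma}{\gamma+\frac{\alpha}{\mu}}, & \frac{\alpha}{\mu}>\gamma,\\[2mm] 1, & \frac{\alpha}{\mu}\le\gamma.\end{cases}$$ (5) The expected equilibrium cost of each customer is tightly upper bounded by $N\gamma$ (it is at most $N\gamma$, and the bound is attained for some parameter values). (6) If $p_0<1$, the remaining support (other than the atom at $0$) is an interval $[t_e,\infty)$, where $t_e>0$.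
   Context: Model. There are $N+1$ customers, each choosing (possibly at random, independently) an arrival time. A single server starts operating at time $0$ and serves First Come First Served; service times are i.i.d. exponential with rate $\mu$. Customers arriving at exactly the same time are admitted in uniformly random order. Each customer pays $\alpha$ per unit of time from arrival until admission into service, and $\gamma$ for every customer ahead of him in the arrival order. When the other $N$ customers arrive independently according to a cdf $F$, the expected cost of arriving at $t$ is $$c_F(t)=-\alpha t\,\mathbf{1}_{\{t<0\}}+\frac{\alpha}{\mu}\mathbb{E}Q_F(t)+\gamma\,\mathbb{E}A_F(t),$$ where $A_F(t)$ is the number of the other customers that have arrived up to time $t$ and $Q_F(t)$ is the number of them present in the system (in queue or in service) at time $t$; if $F$ has an atom at $t$, then of the customers arriving exactly at $t$ only those placed ahead by the random tie-breaking are counted. A symmetric equilibrium arrival distribution is a cdf $F$ for which there is a constant $c_e$ (the equilibrium cost) such that $c_F(t)=c_e$ for all $t$ in the support of $F$ and $c_F(t)\ge c_e$ for every admissible arrival time $t$. Only distributions $F$ whose support is, on any finite interval, a finite union of closed intervals and points are considered. *)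

(* Defs.v *)
From HB Require Import structures.
From mathcomp Require Import all_boot all_order all_algebra all_fingroup.
From mathcomp Require Import all_classical all_reals all_analysis.
Set Implicit Arguments.
Unset Strict Implicit.
Unset Printing Implicit Defensive.
Import Order.TTheory GRing.Theory Num.Theory.
Import numFieldNormedType.Exports.
Local Open Scope classical_set_scope.
Local Open Scope ring_scope.

Section IndependentProduct.
Context {d1 d2 : measure_display} {T1 : measurableType d1}
  {T2 : measurableType d2} {R : realType}.
Variables (P1 : probability T1 R) (P2 : probability T2 R).

Definition prod_prob : set (T1 * T2) -> \bar R := (P1 \x P2)%E.

HB.instance Definition _ := Measure.on prod_prob.

Let prod_prob_setT : prod_prob setT = 1%E.
Proof.
rewrite -setXTT [LHS]product_measure1E// -[RHS]mule1.
by congr (_ * _)%E; exact: probability_setT.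
Qed.

HB.instance Definition _ :=
  Measure_isProbability.Build _ _ _ prod_prob prod_prob_setT.

End IndependentProduct.

Section IidSequence.
Context {d : measure_display} {T : measurableType d} {R : realType}.

Definition pair_cons (n : nat) (p : T * n.-tuple T) : n.+1.-tuple T :=
  [tuple of p.1 :: p.2].

Let measurable_pair_cons n : measurable_fun setT (@pair_cons n).
Proof. exact: measurable_cons. Qed.

HB.instance Definition _ n :=
  isMeasurableFun.Build _ _ _ _ (@pair_cons n) (@measurable_pair_cons n).

(* Joint law of n independent draws from P. *)
Fixpoint iid_prob (P : probability T R) (n : nat) :
    probability (n.-tuple T) R :=
  match n with
  | 0 => \d_([tuple] : 0.-tuple T)
  | m.+1 => distribution (prod_prob P (iid_prob P m)) (@pair_cons m)
  end.

End IidSequence.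

Section Queue.
Context {R : realType}.
Local Notation RB := (measurableTypeR R).

(* Departure times of the customers of l, given as pairs (arrival time, service
   time) in order of admission, when the server is available from time u on. *)
Fixpoint departures (u : R) (l : seq (R * R)) : seq R :=
  if l is c :: l' then
    let dep := Num.max u c.1 + c.2 in dep :: departures dep l'
  else [::].

Section Sample.
(* The tagged customer, arriving at t, has index ord0 and the N other customers
   have the indices lift ord0 j, with (tnth w j).1 the arrival time and
   (tnth w j).2 the service time of the j-th of them. The permutation sg ranks all the N+1
   customers and is only used to break ties between equal arrival times. *)
Variables (N : nat) (t : R) (sg : 'S_N.+1) (w : N.-tuple (RB * RB)).

Definition arrival_time (i : 'I_N.+1) : R :=
  if unlift ord0 i is Some j then (tnth w j).1 else t.

Definition admitted_before (i j : 'I_N.+1) : bool :=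
  (arrival_time i < arrival_time j) ||
  ((arrival_time i == arrival_time j) && (sg i <= sg j)%N).

(* The other customers placed ahead of the tagged one, in order of admission. *)
Definition customers_ahead : seq 'I_N :=
  sort (fun i j => admitted_before (lift ord0 i) (lift ord0 j))
    [seq j <- enum 'I_N | admitted_before (lift ord0 j) ord0].

Definition num_ahead : nat := size customers_ahead.

(* The server starts at time 0; those of the customers ahead whose service is
   not completed at time t are still in the system. *)
Definition num_in_system : nat :=
  count (fun dep => t < dep)
    (departures 0 [seq (tnth w j : R * R) | j <- customers_ahead]).

End Sample.

Section Game.
Variables (N : nat) (alpha gamma mu : R) (mu_gt0 : 0 < mu).

Definition arrival_law (F : cumulativeBounded (0 : R) (1 : R)) :
  probability RB R := lebesgue_stieltjes_measure F.

Definition service_law : probability RB R :=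
  ltac:(unshelve refine (exponential_prob mu); exact: mu_gt0).

Definition others_law (F : cumulativeBounded (0 : R) (1 : R)) :
    probability (N.-tuple (RB * RB)) R :=
  iid_prob (prod_prob (arrival_law F) service_law) N.

(* Expectation over the arrival and service times of the N other customers and
   over a uniformly random tie-breaking order, independent of them. *)
Definition mean_value (F : cumulativeBounded (0 : R) (1 : R))
    (X : 'S_N.+1 -> N.-tuple (RB * RB) -> nat) : R :=
  (\sum_(sg : 'S_N.+1) fine ('E_(others_law F)[fun w => (X sg w)%:R])%E)
    / #|{: 'S_N.+1}|%:R.

Definition cost (F : cumulativeBounded (0 : R) (1 : R)) (t : R) : R :=
  (if t < 0 then - alpha * t else 0)
  + alpha / mu * mean_value F (num_in_system t)
  + gamma * mean_value F (num_ahead t).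

Definition arrival_support (F : cumulativeBounded (0 : R) (1 : R)) : set R :=
  [set t | forall U : set R, open_nbhs t U -> (0 < arrival_law F U)%E].

(* On every bounded interval the support is a finite union of closed intervals
   and points; a point x is the interval [x, x]. *)
Definition tame_support (F : cumulativeBounded (0 : R) (1 : R)) : Prop :=
  forall a b : R, exists s : seq (R * R),
    arrival_support F `&` `[a, b]%classic = \bigcup_(p in [set` s]) `[p.1, p.2]%classic.

(* A is the set of admissible arrival times and ce the equilibrium cost. *)
Definition symmetric_equilibrium (A : set R)
    (F : cumulativeBounded (0 : R) (1 : R)) (ce : R) : Prop :=
  [/\ tame_support F,
      arrival_support F `<=` A,
      forall t, arrival_support F t -> cost F t = ce &
      forall t, A t -> ce <= cost F t].

Definition atom (F : cumulativeBounded (0 : R) (1 : R)) (t : R) : R :=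
  fine (arrival_law F [set t]).

End Game.
End Queue.

(* Main.v *)
(* Write c(t) = alpha t^- + alpha/mu E Q(t) + gamma E A(t). Arriving just before
   an atom saves gamma times the expected number of ties at almost no additional
   waiting, since departure times have no atoms; hence the support contains no
   atom at which an earlier arrival is admissible. As t -> oo the system empties
   while E A(t) -> N, so c(t) -> N gamma, and therefore ce <= N gamma. At a last
   point b of the support without an atom all the others are ahead and some are
   still present, so c(b) > N gamma: the support is unbounded and ce = N gamma.
   Across a gap of the support E A is constant whereas alpha t^- decreases or
   customers leave, so c takes different values at the ends: there is no gap.
   Before time 0 the first point ta satisfies c(ta) = - alpha ta. When arrivals
   start at 0, c(0) = (alpha/mu + gamma) N p0 / 2 gives p0, and for small t > 0
   the p0 N customers in front make c(t) > ce, whence te > 0. The bound on the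
   cost is attained by the point mass at 0 when alpha/mu = gamma. *)

Require Import Defs.
From HB Require Import structures.
From mathcomp Require Import all_boot all_order all_algebra all_fingroup.
From mathcomp Require Import all_classical all_reals all_analysis.
From mathcomp Require Import measurable_realfun ring lra.
Set Implicit Arguments.
Unset Strict Implicit.
Unset Printing Implicit Defensive.
Import Order.TTheory GRing.Theory Num.Theory.
Import numFieldNormedType.Exports.
Local Open Scope classical_set_scope.
Local Open Scope ring_scope.

(** * Real-valued probabilities and continuity along monotone sequences *)

Section RealProbability.
Context {d : measure_display} {T : measurableType d} {R : realType}.
Variable P : probability T R.
Implicit Types A B C : set T.

(** Real values let [lra] and [ring] handle probabilities; on measurable sets [fine] loses
    nothing. *)
Definition pr A : R := fine (P A).

Lemma prE A : measurable A -> P A = (pr A)%:E.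
Proof. by move=> mA; rewrite /pr fineK// fin_num_measure. Qed.

Lemma pr_ge0 A : 0 <= pr A.
Proof. by rewrite /pr fine_ge0. Qed.

Lemma pr0 : pr set0 = 0.
Proof. by rewrite /pr measure0. Qed.

Lemma prT : pr setT = 1.
Proof. by rewrite /pr probability_setT. Qed.

Lemma le_pr A B : measurable A -> measurable B -> A `<=` B -> pr A <= pr B.
Proof.
by move=> mA mB AB; rewrite -lee_fin -!prE// le_measure// inE.
Qed.

Lemma pr_le1 A : measurable A -> pr A <= 1.
Proof. by move=> mA; rewrite -prT; exact: le_pr. Qed.

Lemma prU A B : measurable A -> measurable B -> A `&` B = set0 ->
  pr (A `|` B) = pr A + pr B.
Proof.
move=> mA mB AB; rewrite {1}/pr measureU//.
by rewrite fineD ?fin_num_measure.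
Qed.

Lemma prID A B : measurable A -> measurable B ->
  pr A = pr (A `&` B) + pr (A `\` B).
Proof.
move=> mA mB; rewrite -prU ?setUIDK//.
- exact: measurableI.
- exact: measurableD.
- by apply/seteqP; split => x //= [[_ ?] []].
Qed.

Lemma prC A : measurable A -> pr (~` A) = 1 - pr A.
Proof.
by move=> mA; rewrite -prT (prID measurableT mA) setTI setTD; ring.
Qed.

Lemma le_prU A B : measurable A -> measurable B ->
  pr (A `|` B) <= pr A + pr B.
Proof.
move=> mA mB; have mAB := measurableU A B mA mB; rewrite (prID mAB mA).
apply: lerD; apply: le_pr => //.
- exact: measurableI.
- exact: measurableD.
- by move=> x [[]].
Qed.

Lemma le_prD A B C : measurable A -> measurable B -> measurable C ->
  A `<=` B `|` C -> pr A <= pr B + pr C.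
Proof.
move=> mA mB mC ABC; apply: le_trans (le_prU mB mC).
by apply: le_pr => //; exact: measurableU.
Qed.

Lemma le_pr_bigsetU (I : Type) (r : seq I) (F : I -> set T) :
  (forall i, measurable (F i)) ->
  pr (\big[setU/set0]_(i <- r) F i) <= \sum_(i <- r) pr (F i).
Proof.
move=> mF; elim: r => [|i r IH]; first by rewrite !big_nil pr0.
rewrite !big_cons; apply: le_trans (le_prU (mF i) _) _; last by rewrite lerD2l.
exact: bigsetU_measurable.
Qed.

Lemma pr_bigcup_null (F : nat -> set T) : (forall n, measurable (F n)) ->
  (forall n, pr (F n) = 0) -> pr (\bigcup_n F n) = 0.
Proof.
move=> mF F0; have : P.-negligible (\bigcup_n F n).
  apply: negligible_bigcup => n; apply/negligibleP => //.
  have : P (F n) = 0%E by rewrite prE// F0.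
  exact.
move/negligibleP => /(_ (bigcup_measurable (fun n _ => mF n))).
by rewrite /pr => ->.
Qed.

Lemma pr_bigcap_lt (F : nat -> set T) (e : R) : (forall n, measurable (F n)) ->
  nonincreasing_seq F -> pr (\bigcap_n F n) = 0 -> 0 < e ->
  exists n, pr (F n) < e.
Proof.
move=> mF niF F0 e0.
have mI : measurable (\bigcap_n F n) by exact: bigcap_measurable.
have : P \o F @ \oo --> P (\bigcap_n F n).
  apply: nonincreasing_cvg_mu => //.
  by rewrite ltey_eq fin_num_measure.
rewrite prE// F0 => /fine_cvgP[_ /cvgrPdist_lt]/(_ e e0) [n _ /(_ n) /=].
move=> /(_ (leqnn n)) Fn; exists n; apply: le_lt_trans Fn.
by rewrite sub0r normrN ler_norm.
Qed.

(** Monotonicity lets the maximum of the individual indices serve all [i]. This yields bounds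
    uniform in the tie-breaking permutation and in the customer. *)
Lemma pr_bigcap_lt_fin (I : finType) (F : I -> nat -> set T) (e : R) :
  (forall i n, measurable (F i n)) -> (forall i, nonincreasing_seq (F i)) ->
  (forall i, pr (\bigcap_n F i n) = 0) -> 0 < e ->
  exists n, forall i, pr (F i n) < e.
Proof.
move=> mF niF F0 e0.
have /choice[f fP] i : exists n, pr (F i n) < e by exact: pr_bigcap_lt.
exists (\max_i f i) => i; apply: le_lt_trans (fP i); apply: le_pr => //.
by apply/subsetPset/niF; exact: leq_bigmax.
Qed.

Lemma pr_bigcup_gt (F : nat -> set T) (e : R) : (forall n, measurable (F n)) ->
  nondecreasing_seq F -> pr (\bigcup_n F n) = 1 -> 0 < e ->
  exists n, 1 - e < pr (F n).
Proof.
move=> mF ndF F1 e0.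
have [||||n] := @pr_bigcap_lt (fun n => ~` F n) e => //.
- by move=> n; exact: measurableC.
- by move=> n m nm; apply/subsetPset/subsetC/subsetPset/ndF.
- by rewrite -setC_bigcup prC ?F1 ?subrr//; exact: bigcup_measurable.
- by rewrite prC// => ?; exists n; lra.
Qed.

(** Linearity of expectation for a sum of indicators: it reduces mean queue lengths to probabilities
    about single customers. *)
Lemma mean_count (n : nat) (X : T -> nat) (b : 'I_n -> T -> bool) :
  (forall w, X w = \sum_(j < n) b j w)%N ->
  (forall j, measurable [set w | b j w]) ->
  fine ('E_P[fun w => (X w)%:R])%E = \sum_(j < n) pr [set w | b j w].
Proof.
move=> Xb mb; rewrite unlock.
transitivity (fine (\int[P]_w \sum_(j < n) (\1_[set w | b j w] w)%:E)%E).
  congr fine; apply: eq_integral => w _; rewrite Xb natr_sum sumEFin.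
  congr EFin; apply: eq_bigr => j _; rewrite indicE.
  by case: (boolP (b j w)) => bjw;
    [rewrite mem_set|rewrite memNset//=; exact/negP].
rewrite ge0_integral_sum//=; last first.
  by move=> j; apply/measurable_EFinP; exact: measurable_indic.
rewrite (eq_bigr (fun j => (pr [set w | b j w])%:E)) => [|j _].
  by rewrite sumEFin.
by rewrite integral_indic// setIT; exact: prE.
Qed.

End RealProbability.

(** * Independent coordinates *)

Section IndependentCoordinates.
Context {d : measure_display} {T : measurableType d} {R : realType}.
Variable P : probability T R.

Lemma pr_prod {d1 d2} {T1 : measurableType d1} {T2 : measurableType d2}
    (P1 : probability T1 R) (P2 : probability T2 R) A B :
  measurable A -> measurable B ->
  pr (prod_prob P1 P2) (A `*` B) = pr P1 A * pr P2 B.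
Proof.
move=> mA mB; rewrite /pr -fineM ?fin_num_measure//; congr fine.
exact: product_measure1E.
Qed.

Lemma pr_prod_xsection_null {d1 d2} {T1 : measurableType d1}
    {T2 : measurableType d2} (P1 : probability T1 R) (P2 : probability T2 R) A :
  (forall x, pr P2 (xsection A x) = 0) -> measurable A ->
  pr (prod_prob P1 P2) A = 0.
Proof.
move=> A0 mA; rewrite /pr [X in fine X](_ : _ = 0%E)//.
transitivity (\int[P1]_x P2 (xsection A x))%E => //.
apply: integral0_eq => x _.
by rewrite prE ?A0//; exact: measurable_xsection.
Qed.

(** Uniqueness of the product measure allows integrating in the other order. *)
Lemma pr_prod_ysection_null {d1 d2} {T1 : measurableType d1}
    {T2 : measurableType d2} (P1 : probability T1 R) (P2 : probability T2 R) A :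
  (forall y, pr P1 (ysection A y) = 0) -> measurable A ->
  pr (prod_prob P1 P2) A = 0.
Proof.
move=> A0 mA; rewrite /pr [X in fine X](_ : _ = 0%E)//.
transitivity ((P1 \x^ P2)%E A).
  by apply: product_measure_unique => // B C mB mC; exact: product_measure2E.
apply: integral0_eq => y _ /=.
by rewrite prE ?A0//; exact: measurable_ysection.
Qed.

Lemma pr_iidS n (A : set (n.+1.-tuple T)) :
  pr (iid_prob P n.+1) A =
  pr (prod_prob P (iid_prob P n)) ((@pair_cons _ T n) @^-1` A).
Proof. by []. Qed.

Lemma measurable_box n (B : 'I_n -> set T) : (forall i, measurable (B i)) ->
  measurable [set w : n.-tuple T | forall i, B i (tnth w i)].
Proof.
move=> mB; rewrite (_ : [set w | _] =
  \bigcap_(i in [set: 'I_n]) [set w : n.-tuple T | B i (tnth w i)]).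
  apply: fin_bigcap_measurable => // i _; rewrite -[X in measurable X]setTI.
  exact: measurable_tnth.
by apply/seteqP; split => w /= Bw i => [_|]; exact: Bw.
Qed.

Lemma pr_box n (B : 'I_n -> set T) : (forall i, measurable (B i)) ->
  pr (iid_prob P n) [set w | forall i, B i (tnth w i)] =
  \prod_(i < n) pr P (B i).
Proof.
elim: n B => [|n IH] B mB.
  rewrite big_ord0 -(prT (iid_prob P 0)); congr pr.
  by apply/seteqP; split => // w _ [].
rewrite pr_iidS big_ord_recl -(IH (fun i => B (lift ord0 i)))//.
rewrite -pr_prod//; last exact: measurable_box (fun i => mB (lift ord0 i)).
congr pr; apply/seteqP; split => -[x w] /=.
  move=> Bw; split => [|i]; first by have := Bw ord0.
  by have := Bw (lift ord0 i); rewrite tnthS.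
move=> [Bx Bw] i; have [j ->|->] := unliftP ord0 i; last exact: Bx.
by rewrite tnthS; exact: Bw.
Qed.

Lemma pr_coord n (j : 'I_n) (B : set T) : measurable B ->
  pr (iid_prob P n) [set w | B (tnth w j)] = pr P B.
Proof.
(* An event about one coordinate is a box whose other sides are the full space. *)
move=> mB; pose C i := if i == j then B else setT.
rewrite (_ : [set w | _] = [set w : n.-tuple T| forall i, C i (tnth w i)]).
  rewrite pr_box /C => [|i]; last by case: ifP.
  by rewrite (bigD1 j)//= eqxx big1 ?mulr1// => i /negPf ->; rewrite prT.
apply/seteqP; split => w /=; rewrite /C => Bw.
  by move=> i; case: ifP => // /eqP ->.
by have := Bw j; rewrite eqxx.
Qed.

Definition set_coord n (w : n.-tuple T) (j : 'I_n) (x : T) : n.-tuple T :=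
  [tuple if i == j then x else tnth w i | i < n].

Lemma set_coord_lift n (x y : T) (w : n.-tuple T) (j : 'I_n) :
  set_coord (pair_cons (x, w)) (lift ord0 j) y =
  pair_cons (x, set_coord w j y).
Proof.
apply: eq_from_tnth => i; rewrite tnth_mktuple.
have [k ->|->] := unliftP ord0 i; last by rewrite (negPf (neq_lift _ _)).
by rewrite !tnthS tnth_mktuple (inj_eq lift_inj).
Qed.

Lemma set_coord0 n (x y : T) (w : n.-tuple T) :
  set_coord (pair_cons (x, w)) ord0 y = pair_cons (y, w).
Proof.
apply: eq_from_tnth => i; rewrite tnth_mktuple.
have [k ->|->] := unliftP ord0 i; last by rewrite eqxx.
by rewrite eq_sym (negPf (neq_lift _ _)) !tnthS.
Qed.

(** Fubini in the [j]-th coordinate. The induction peels off the head: if [j] lies in the tail, the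
    head is frozen; if [j] is the head, the tail is frozen. *)
Lemma pr_null_coord n (j : 'I_n) (A : set (n.-tuple T)) : measurable A ->
  (forall w, pr P [set x | A (set_coord w j x)] = 0) ->
  pr (iid_prob P n) A = 0.
Proof.
elim: n j A => [[]//|n IH] j A mA A0.
have mC : measurable ((@pair_cons _ T n) @^-1` A).
  by rewrite -[X in measurable X]setTI; exact: measurable_cons.
rewrite pr_iidS; have [j' jj'|j0] := unliftP ord0 j.
- apply: pr_prod_xsection_null => // x; apply: (IH j').
    exact: measurable_xsection.
  move=> w; rewrite -[RHS](A0 (pair_cons (x, w))) xsectionE jj'.
  by congr pr; apply/funext => y /=; rewrite set_coord_lift.
- apply: pr_prod_ysection_null => // w; rewrite ysectionE.
  (* Some point of [T] is needed to complete [w] to a tuple in which the head is then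
     overwritten. *)
  have [[x]|noT] := pselect ($|{: T}|); last first.
    rewrite [X in pr P X](_ : _ = set0) ?pr0//.
    by apply/seteqP; split => // x _; apply: noT.
  rewrite -[RHS](A0 (pair_cons (x, w))) j0.
  by congr pr; apply/funext => y /=; rewrite set_coord0.
Qed.

End IndependentCoordinates.

(** * Departure times *)

Section Departures.
Context {R : realType} (N : nat) (sg : 'S_N.+1).
Local Notation RB := (measurableTypeR R).
Implicit Types (w : N.-tuple (RB * RB)) (i j k : 'I_N).

Definition arr w j : R := (tnth w j).1.
Definition srv w j : R := (tnth w j).2.

(** This is [admitted_before] among the other customers, where the arrival time [t] of the tagged
    one drops out. Hence [departure] below does not depend on [t]. *)
Definition prec w i j : bool :=
  (arr w i < arr w j) ||
  ((arr w i == arr w j) && (sg (lift ord0 i) <= sg (lift ord0 j))%N).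

Definition ahead (t : R) w j : bool :=
  (arr w j < t) || ((arr w j == t) && (sg (lift ord0 j) <= sg ord0)%N).

Lemma admitted_before_lift t w i j :
  admitted_before t sg w (lift ord0 i) (lift ord0 j) = prec w i j.
Proof. by rewrite /admitted_before /arrival_time !liftK. Qed.

Lemma admitted_before_ord0 t w j :
  admitted_before t sg w (lift ord0 j) ord0 = ahead t w j.
Proof. by rewrite /admitted_before /arrival_time liftK unlift_none. Qed.

Lemma prec_refl w : reflexive (prec w).
Proof. by move=> i; rewrite /prec eqxx leqnn orbT. Qed.

Lemma prec_total w : total (prec w).
Proof.
by move=> i j; rewrite /prec; case: ltgtP => //= _; exact: leq_total.
Qed.

Lemma prec_trans w : transitive (prec w).
Proof.
move=> j i k; rewrite /prec => /orP[ij|/andP[/eqP -> ij]].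
  by move=> /orP[/(lt_trans ij)|/andP[/eqP <- _]]; rewrite ?ij// => ->.
move=> /orP[->//|/andP[-> /(leq_trans ij) ->]]; by rewrite orbT.
Qed.

Lemma prec_anti w i j : prec w i j -> prec w j i -> i = j.
Proof.
rewrite /prec; case: ltgtP => //= _ ij ji.
have /val_inj/perm_inj/lift_inj// :
  sg (lift ord0 i) = sg (lift ord0 j) :> nat.
by apply/eqP; rewrite eqn_leq ij.
Qed.

Lemma ahead_prec t w i j : prec w i j -> ahead t w j -> ahead t w i.
Proof.
rewrite /prec /ahead => /orP[ij|/andP[/eqP -> ij]].
  by move=> /orP[/(lt_trans ij)|/andP[/eqP <- _]]; rewrite ?ij// => ->.
move=> /orP[->//|/andP[-> /(leq_trans ij) ->]]; by rewrite orbT.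
Qed.

(* The solution of the recursion defining [departures]: the server becomes busy
   for the last time before the departure of j either at time 0 or when some i
   arrives. *)
Definition departure w j : R :=
  \big[Num.max/(\sum_(k | prec w k j) srv w k)]_(i | prec w i j)
    (arr w i + \sum_(k | prec w i k && prec w k j) srv w k).

Lemma departure_first w j : (forall k, prec w k j = (k == j)) ->
  departure w j = Num.max 0 (arr w j) + srv w j.
Proof.
move=> pj; rewrite /departure (bigmaxD1 j) ?prec_refl//.
rewrite [X in Num.max _ X]big_pred0 => [|i]; last by rewrite pj andbN.
rewrite (big_pred1 j) => [|k]; last first.
  by rewrite pj /= andbC; case: eqVneq => //= ->; rewrite prec_refl.
by rewrite (big_pred1 j)// addr_maxl add0r maxC.
Qed.

(** Here [i] is the immediate predecessor of [j]. The terms of the maximum for [j] are those for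
    [i], each increased by the service of [j], and one new term in which [j] finds the server
    idle. *)
Lemma departure_next w i j : ~~ prec w j i ->
  (forall k, prec w k j = (k == j) || prec w k i) ->
  departure w j = Num.max (departure w i) (arr w j) + srv w j.
Proof.
move=> ji pj.
have sumE (A : 'I_N -> bool) : A j ->
    \sum_(k | A k && prec w k j) srv w k =
    \sum_(k | A k && prec w k i) srv w k + srv w j.
  move=> Aj; rewrite (bigD1 j) ?Aj ?prec_refl//= addrC; congr (_ + _).
  apply: eq_bigl => k; rewrite pj; case: eqVneq => [->|_] /=; last first.
    by rewrite andbT.
  by rewrite (negPf ji) !andbF.
rewrite /departure (bigmaxD1 j) ?prec_refl// maxC addr_maxl.
congr Num.max; last first.
  rewrite (big_pred1 j)// => k /=; apply/andP/eqP => [[jk kj]|->].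
    exact: prec_anti jk.
  by rewrite prec_refl.
rewrite (big_morph (fun x => x + srv w j)
  (fun x y => addr_maxl x y _) (erefl _)).
rewrite (sumE xpredT)//; apply: eq_big => k.
  rewrite pj; case: eqVneq => [->|_] /=; last by rewrite andbT.
  by rewrite (negPf ji).
move=> /andP[kj kNj]; rewrite sumE ?addrA//.
Qed.

Lemma departures_rcons (u : R) (l : seq (R * R)) c :
  departures u (rcons l c) =
  rcons (departures u l) (Num.max (last u (departures u l)) c.1 + c.2).
Proof. by elim: l u => //= a l IH u; rewrite IH. Qed.

(** Closure under predecessors makes [l] an initial segment of the admission order, so [departure],
    defined from all customers, sees only members of [l]. The induction adds the last customer,
    whose departure depends on the one just before. *)
Lemma departuresE w (l : seq 'I_N) : pairwise (prec w) l -> uniq l ->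
  (forall i j, prec w i j -> j \in l -> i \in l) ->
  departures 0 [seq (tnth w j : R * R) | j <- l] = [seq departure w j | j <- l].
Proof.
elim/last_ind: l => // l j IH; rewrite pairwise_rcons rcons_uniq.
move=> /andP[/allP lj sl] /andP[jl ul] cl.
have cl' i k : prec w i k -> k \in l -> i \in l.
  move=> ik kl; have := cl _ _ ik; rewrite !mem_rcons !inE kl orbT => /(_ isT).
  case: eqVneq => [ij _|//]; rewrite ij in ik.
  by move: jl; rewrite (prec_anti ik (lj _ kl)) kl.
have pj k : prec w k j = (k == j) || (k \in l).
  apply/idP/orP => [kj|[/eqP ->|]]; [|exact: prec_refl|exact: lj].
  by apply/orP; have := cl _ _ kj; rewrite !mem_rcons !inE eqxx => ->.
rewrite !map_rcons departures_rcons IH//; congr rcons.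
case/lastP: l => [|l i] in IH lj sl jl ul cl cl' pj *.
  by rewrite departure_first// => k; rewrite pj in_nil orbF.
have pi k : prec w k i = (k \in rcons l i).
  apply/idP/idP => [ki|]; first by apply: cl' ki _; rewrite mem_rcons inE eqxx.
  rewrite mem_rcons inE => /predU1P[->|kl]; first exact: prec_refl.
  by move: sl; rewrite pairwise_rcons => /andP[/allP /(_ _ kl)].
rewrite map_rcons last_rcons (departure_next (i := i) (j := j)) ?pi// => k.
by rewrite pi.
Qed.

Lemma perm_customers_ahead t w :
  perm_eq (customers_ahead t sg w) [seq j <- enum 'I_N | ahead t w j].
Proof.
rewrite /customers_ahead perm_sort; apply/seq.permP => p; congr count.
by apply: eq_filter => j; exact: admitted_before_ord0.
Qed.

Lemma num_aheadE t w : (num_ahead t sg w = \sum_(j < N) ahead t w j)%N.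
Proof.
rewrite /num_ahead (perm_size (perm_customers_ahead t w)) size_filter.
by rewrite -sum1_count big_mkcond big_enum; apply: eq_bigr => j _; case: ahead.
Qed.

Lemma num_in_systemE t w :
  (num_in_system t sg w =
   \sum_(j < N) (ahead t w j && (t < departure w j)%R))%N.
Proof.
have pca := perm_customers_ahead t w.
rewrite /num_in_system departuresE.
- rewrite count_map (seq.permP pca) count_filter -sum1_count.
  rewrite big_mkcond big_enum.
  by apply: eq_bigr => j _ /=; rewrite andbC; case: andb.
- rewrite -sorted_pairwise; last exact: prec_trans.
  rewrite /customers_ahead (_ : (fun i j => _) = prec w).
    exact/sort_sorted/prec_total.
  by apply/funext => i; apply/funext => j; exact: admitted_before_lift.
- by rewrite (perm_uniq pca) filter_uniq// enum_uniq.
- move=> i j ij; rewrite !(perm_mem pca) mem_filter => /andP[aj _].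
  by rewrite mem_filter (ahead_prec ij aj) mem_enum.
Qed.

End Departures.

(** * Measurability of departure times and their dependence on one service time *)

Lemma measurable_bigmax {R : realType} d (T : measurableType d) (I : Type)
    (s : seq I) (h0 : T -> R) (h : I -> T -> R) :
  measurable_fun setT h0 -> (forall i, measurable_fun setT (h i)) ->
  measurable_fun setT (fun x => \big[Num.max/h0 x]_(i <- s) h i x).
Proof.
move=> mh0 mh; elim: s => [|i s IH].
  by rewrite (_ : (fun _ => _) = h0)//; apply/funext => x; rewrite big_nil.
rewrite (_ : (fun _ => _) =
    fun x => Num.max (h i x) (\big[Num.max/h0 x]_(i <- s) h i x)).
  exact: measurable_maxr.
by apply/funext => x; rewrite big_cons.
Qed.

Section MeasurableDepartures.
Context {R : realType} (N : nat) (sg : 'S_N.+1).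
Local Notation RB := (measurableTypeR R).
Local Notation sample := (N.-tuple (RB * RB)).
Implicit Types (w : sample) (i j k : 'I_N).

Lemma measurable_arr j : measurable_fun setT (fun w : sample => arr w j : RB).
Proof.
apply: (@measurableT_comp _ _ _ _ _ _ (fst : RB * RB -> RB)) => //.
exact: measurable_tnth.
Qed.

Lemma measurable_srv j : measurable_fun setT (fun w : sample => srv w j : RB).
Proof.
apply: (@measurableT_comp _ _ _ _ _ _ (snd : RB * RB -> RB)) => //.
exact: measurable_tnth.
Qed.

Lemma measurable_fun_pred d (T : measurableType d) (b : T -> bool) :
  measurable_fun setT b -> measurable [set x | b x].
Proof.
move=> mb; rewrite -[X in measurable X]setTI.
exact: (mb measurableT [set true]).
Qed.

Lemma measurable_prec i j :
  measurable_fun setT (fun w : sample => prec sg w i j).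
Proof.
have [mi mj] := (measurable_arr i, measurable_arr j).
apply: measurable_or; first exact: measurable_fun_ltr.
by apply: measurable_and; [exact: measurable_fun_eqr|exact: measurable_cst].
Qed.

Lemma measurable_ahead t j :
  measurable_fun setT (fun w : sample => ahead sg t w j).
Proof.
have mj := measurable_arr j.
apply: measurable_or; first exact: measurable_fun_ltr.
by apply: measurable_and; [exact: measurable_fun_eqr|exact: measurable_cst].
Qed.

Lemma measurable_departure j :
  measurable_fun setT (fun w : sample => departure sg w j : RB).
Proof.
have ms (b : sample -> 'I_N -> bool) :
    (forall k, measurable_fun setT (fun w => b w k)) ->
    measurable_fun setT (fun w : sample => \sum_(k | b w k) srv w k : RB).
  move=> mb; under eq_fun do rewrite big_mkcond.
  apply: measurable_sum => k; apply: measurable_fun_ifT => //.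
  exact: measurable_srv.
have mbase := ms _ (fun k => measurable_prec k j).
rewrite /departure; under eq_fun do rewrite bigmax_mkcond.
apply: measurable_bigmax => // i; apply: measurable_fun_ifT => //.
  exact: measurable_prec.
apply: measurable_funD; first exact: measurable_arr.
by apply: ms => k; apply: measurable_and; exact: measurable_prec.
Qed.

Lemma measurable_departure_gt t j :
  measurable [set w : sample | t < departure sg w j].
Proof.
apply: measurable_fun_pred; apply: measurable_fun_ltr => //.
exact: measurable_departure.
Qed.

Lemma measurable_departure_itv (I : interval R) j :
  measurable [set w : sample | departure sg w j \in I].
Proof.
rewrite -[X in measurable X]setTI.
exact: (measurable_departure j measurableT (measurable_itv I)).
Qed.

Lemma measurable_in_system t j : measurable
  [set w : sample | ahead sg t w j && (t < departure sg w j)].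
Proof.
apply: measurable_fun_pred; apply: measurable_and.
  exact: measurable_ahead.
by apply: measurable_fun_ltr => //; exact: measurable_departure.
Qed.

(** The base term of the maximum, the total service up to [j] started at time 0, already contains
    the service of [j]. *)
Lemma srv_le_departure w j : (forall k, 0 <= srv w k) ->
  srv w j <= departure sg w j.
Proof.
move=> w0; apply: le_trans (bigmax_ge_id _ _ _ _).
by rewrite (bigD1 j) ?prec_refl//= lerDl sumr_ge0.
Qed.

(** Precedence depends on arrival times only, and every term of the maximum contains the service of
    [j] exactly once. *)
Lemma departure_set_coord w j (a s : RB) :
  departure sg (set_coord w j (a, s)) j =
  departure sg (set_coord w j (a, 0)) j + s.
Proof.
have arrE k : arr (set_coord w j (a, s)) k = arr (set_coord w j (a, 0)) k.
  by rewrite /arr !tnth_mktuple; case: ifP.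
have precE i k :
    prec sg (set_coord w j (a, s)) i k = prec sg (set_coord w j (a, 0)) i k.
  by rewrite /prec !arrE.
have sumE (A : 'I_N -> bool) : A j ->
    \sum_(k | A k) srv (set_coord w j (a, s)) k =
    \sum_(k | A k) srv (set_coord w j (a, 0)) k + s.
  move=> Aj; rewrite (bigD1 j)//= [in RHS](bigD1 j)//=.
  rewrite /srv !tnth_mktuple eqxx/= add0r addrC; congr (_ + _).
  by apply: eq_bigr => k /andP[_ /negPf kj]; rewrite !tnth_mktuple kj.
rewrite /departure.
rewrite (big_morph (fun x => x + s) (fun x y => addr_maxl x y _) (erefl _)).
rewrite (eq_bigl _ _ (fun k => precE k j)) sumE ?prec_refl//.
rewrite (eq_bigl _ _ (fun k => precE k j)); apply: eq_bigr => k kj.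
rewrite arrE -addrA; congr (_ + _).
by rewrite -sumE ?kj ?prec_refl//; apply: eq_bigl => i; rewrite !precE.
Qed.

Lemma exists_first w : (0 < N)%N ->
  exists j, forall k, prec sg w k j = (k == j).
Proof.
move=> N0; pose l := sort (prec sg w) (enum 'I_N).
have sl : pairwise (prec sg w) l.
  rewrite -sorted_pairwise; last exact: prec_trans.
  exact/sort_sorted/prec_total.
have ml k : k \in l by rewrite mem_sort mem_enum.
case: l sl ml => [|j l] /= sl ml; first by have := ml (Ordinal N0).
exists j => k; apply/idP/eqP => [kj|->]; last exact: prec_refl.
have := ml k; rewrite inE => /predU1P[//|kl].
have /andP[/allP /(_ _ kl) jk _] := sl.
exact: prec_anti kj jk.
Qed.

End MeasurableDepartures.

(** * Probabilities of events about one customer in the random sample *)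

Section Sampling.
Context {R : realType} (N : nat).
Local Notation RB := (measurableTypeR R).
Local Notation sample := (N.-tuple (RB * RB)).
Variables (A S : probability RB R).
Hypothesis S_set1 : forall x : R, pr S [set x] = 0.
Hypothesis S_neg : pr S `]-oo, 0[%classic = 0.
Implicit Types (w : sample) (j : 'I_N) (sg : 'S_N.+1).

Definition joint_law : probability sample R := iid_prob (prod_prob A S) N.

Lemma pr_arr j (B : set RB) : measurable B ->
  pr joint_law [set w | B (arr w j)] = pr A B.
Proof.
move=> mB; have := @pr_coord _ _ _ (prod_prob A S) N j (B `*` setT).
rewrite pr_prod// prT mulr1 => <-; last exact: measurableX.
by congr pr; apply/seteqP; split => w //= -[].
Qed.

Lemma measurable_arr_srv j (B C : set RB) : measurable B -> measurable C ->
  measurable [set w : sample | B (arr w j) /\ C (srv w j)].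
Proof.
move=> mB mC; apply: measurableI; rewrite -[X in measurable X]setTI.
  exact: measurable_arr.
exact: measurable_srv.
Qed.

Lemma pr_arr_srv j (B C : set RB) : measurable B -> measurable C ->
  pr joint_law [set w | B (arr w j) /\ C (srv w j)] = pr A B * pr S C.
Proof.
move=> mB mC; rewrite -pr_prod//.
by apply: (@pr_coord _ _ _ (prod_prob A S) N j (B `*` C)); exact: measurableX.
Qed.

Definition services_ge0 : set sample := [set w | forall j, 0 <= srv w j].

Let half : 'I_N -> set (RB * RB) := fun=> setT `*` `[0, +oo[%classic.

Let services_ge0E : services_ge0 = [set w | forall i, half i (tnth w i)].
Proof.
apply/seteqP; split => w /= w0 j.
  by split => //; rewrite /= in_itv/= andbT; exact: w0.
by have [_ /=] := w0 j; rewrite in_itv/= andbT.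
Qed.

Lemma measurable_srv_ge0 : measurable services_ge0.
Proof.
by rewrite services_ge0E; apply: measurable_box => i; exact: measurableX.
Qed.

Lemma pr_srv_ge0 : pr joint_law services_ge0 = 1.
Proof.
rewrite services_ge0E pr_box => [|i]; last exact: measurableX.
rewrite big1// => i _; rewrite pr_prod// prT mul1r -setCitvl prC//.
by rewrite S_neg subr0.
Qed.

(** Service times are nonnegative only almost surely, so inclusions between events are checked on
    that event of probability 1. *)
Lemma le_pr_srv_ge0 (X Y : set sample) : measurable X -> measurable Y ->
  X `&` services_ge0 `<=` Y -> pr joint_law X <= pr joint_law Y.
Proof.
move=> mX mY XY; have m0 := measurable_srv_ge0.
have -> : pr joint_law Y = pr joint_law Y + pr joint_law (~` services_ge0).
  by rewrite prC// pr_srv_ge0 subrr addr0.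
apply: le_prD => //; first exact: measurableC.
by move=> w Xw; have [w0|w0] := pselect (services_ge0 w);
  [left; exact: XY|right].
Qed.

(* With everything else fixed, departure j is a translate of the service time of
   j, whose law has no atom. *)
Lemma pr_departure_set1 sg j t :
  pr joint_law [set w | departure sg w j = t] = 0.
Proof.
have mD : measurable [set w : sample | departure sg w j = t].
  rewrite -[X in measurable X]setTI.
  exact: (measurable_departure sg j measurableT (measurable_set1 t)).
apply: (pr_null_coord (j := j)) => // w.
have mx : measurable [set x : RB * RB | departure sg (set_coord w j x) j = t].
  rewrite -[X in measurable X]setTI.
  rewrite (_ : _ `&` _ = setT `&`
    (fun x => departure sg (set_coord w j x) j : RB) @^-1` [set t])//.
  apply: (measurableT_comp (measurable_departure sg j)) => //.
  apply/measurable_fun_tnthP => i.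
  rewrite (_ : _ \o _ = fun x => if i == j then x else tnth w i).
    by case: eqP => _; [exact: measurable_id|exact: measurable_cst].
  by apply/funext => x /=; rewrite tnth_mktuple.
apply: pr_prod_xsection_null => // a.
set D := departure sg (set_coord w j (a, 0)) j.
rewrite -[RHS](S_set1 (t - D)); congr pr.
rewrite xsectionE; apply/seteqP; split => s /=; rewrite departure_set_coord -/D.
  by move=> <-; rewrite addrAC subrr add0r.
by move=> ->; rewrite addrCA subrr addr0.
Qed.

Lemma measurable_le_departure sg j (B : set RB) (u : R) : measurable B ->
  measurable [set w : sample | B (arr w j) /\ u < departure sg w j].
Proof.
move=> mB; apply: measurableI; last exact: measurable_departure_gt.
by rewrite -[X in measurable X]setTI; exact: measurable_arr.
Qed.

(** The server starts at 0, so a service longer than [u] cannot end by [u]; service and arrival are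
    independent. *)
Lemma pr_arr_departure_ge sg j (B : set RB) (u : R) : measurable B ->
  pr A B * pr S `]u, +oo[%classic <=
  pr joint_law [set w | B (arr w j) /\ u < departure sg w j].
Proof.
move=> mB; rewrite -(pr_arr_srv j)//; apply: le_pr_srv_ge0.
- exact: measurable_arr_srv.
- exact: measurable_le_departure.
move=> w [[Bw]]; rewrite /= in_itv/= andbT => uw w0; split => //.
exact: lt_le_trans (srv_le_departure _ _ w0).
Qed.

Lemma pr_ahead sg t j :
  pr joint_law [set w | ahead sg t w j] =
  pr A `]-oo, t[%classic + (sg (lift ord0 j) <= sg ord0)%N%:R * pr A [set t].
Proof.
rewrite -(pr_arr j (measurable_itv `]-oo, t[)) -(pr_arr j (measurable_set1 t)).
have mB (B : set RB) : measurable B ->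
    measurable [set w : sample | B (arr w j)].
  by move=> mB; rewrite -[X in measurable X]setTI; exact: measurable_arr.
case: leqP => sgj; rewrite ?mul0r ?mul1r ?addr0.
  rewrite -prU; [|exact: mB|exact: mB|].
    congr pr; apply/seteqP; split => w /=; rewrite /ahead in_itv/= sgj andbT.
      by move=> /orP[|/eqP]; [left|right].
    by move=> [->//|->]; rewrite eqxx orbT.
  by apply/seteqP; split => // w [] /=;
    rewrite in_itv/= => + wt; rewrite wt ltxx.
congr pr; apply/seteqP; split => w /=;
  by rewrite /ahead in_itv/= leqNgt sgj andbF orbF.
Qed.

Lemma pr_in_system_ge sg j t :
  pr A `]-oo, t[%classic * pr S `]t, +oo[%classic <=
  pr joint_law [set w | ahead sg t w j && (t < departure sg w j)].
Proof.
apply: le_trans (pr_arr_departure_ge sg j t (measurable_itv _)) _.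
apply: le_pr; [exact: measurable_le_departure|exact: measurable_in_system|].
by move=> w /= [+ ->]; rewrite in_itv/= /ahead => ->.
Qed.

Lemma pr_in_system_le sg j t :
  pr joint_law [set w | ahead sg t w j && (t < departure sg w j)] <=
  pr joint_law [set w | ahead sg t w j].
Proof.
apply: le_pr; [exact: measurable_in_system| |by move=> w /andP[]].
by apply: measurable_fun_pred; exact: measurable_ahead.
Qed.

(** Services are almost surely positive and none begins before 0, so nobody has left at time 0. *)
Lemma pr_in_system0 sg j :
  pr joint_law [set w | ahead sg 0 w j && (0 < departure sg w j)] =
  pr joint_law [set w | ahead sg 0 w j].
Proof.
apply/eqP; rewrite eq_le pr_in_system_le/=.
have mS0 : measurable [set w : sample | srv w j = 0].
  rewrite -[X in measurable X]setTI.
  exact: (measurable_srv j measurableT (measurable_set1 (0 : R))).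
have S0 : pr joint_law [set w | srv w j = 0] = 0.
  transitivity (pr A setT * pr S [set 0]); last by rewrite S_set1 mulr0.
  by rewrite -(pr_arr_srv j)//; congr pr; apply/seteqP; split => w //= -[].
have := le_prU joint_law (measurable_in_system sg 0 j) mS0.
rewrite S0 addr0; apply: le_trans.
apply: le_pr_srv_ge0.
- by apply: measurable_fun_pred; exact: measurable_ahead.
- by apply: measurableU => //; exact: measurable_in_system.
move=> w [/= ->] w0; have [->|s0] := eqVneq (srv w j) 0; [by right|left].
by apply: lt_le_trans (srv_le_departure _ _ w0); rewrite lt_def s0 w0.
Qed.

(** Departure times are finite, and there are finitely many pairs [(sg, j)]. *)
Lemma departure_tail (e : R) : 0 < e -> exists u : R, forall t, u <= t ->
  forall sg j, pr joint_law [set w | t < departure sg w j] < e.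
Proof.
move=> e0.
pose F (p : 'S_N.+1 * 'I_N) (n : nat) :=
  [set w : sample | n%:R < departure p.1 w p.2].
have [||||n nP] := @pr_bigcap_lt_fin _ _ _ joint_law _ F e => //.
- by move=> p n; exact: measurable_departure_gt.
- move=> p m n mn; apply/subsetPset => w /=; apply: le_lt_trans.
  by rewrite ler_nat.
- move=> p; rewrite (_ : \bigcap_n _ = set0) ?pr0//.
  rewrite -subset0 => w /= /(_ (Num.truncn (departure p.1 w p.2)).+1 I).
  by rewrite /F/= ltNge ltW// truncnS_gt.
exists n%:R => t nt sg j; apply: le_lt_trans (nP (sg, j)); apply: le_pr.
- exact: measurable_departure_gt.
- exact: measurable_departure_gt.
- by move=> w /=; exact: le_lt_trans.
Qed.

(** The intervals shrink to the point [t], at which no departure time has an atom. *)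
Lemma departure_left (t e : R) : 0 < e -> exists2 u : R, u < t &
  forall t', u <= t' -> forall sg j,
    pr joint_law [set w | departure sg w j \in `]t', t]] < e.
Proof.
move=> e0.
pose F (p : 'S_N.+1 * 'I_N) (n : nat) :=
  [set w : sample | departure p.1 w p.2 \in `]t - n.+1%:R^-1, t]].
have [||||n nP] := @pr_bigcap_lt_fin _ _ _ joint_law _ F e => //.
- by move=> p n; exact: measurable_departure_itv.
- move=> p m n mn; apply/subsetPset => w; rewrite /F/= !in_itv/=.
  move=> /andP[tw ->]; rewrite andbT; apply: le_lt_trans tw.
  by rewrite lerD2l lerN2 lef_pV2 ?posrE// ler_nat.
- move=> p; rewrite -[RHS](pr_departure_set1 p.1 p.2 t); congr pr.
  apply/seteqP; split => w /=.
    move=> tw; apply/eqP; rewrite eq_le; apply/andP; split.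
      by have := tw 0%N I; rewrite /F/= in_itv/= => /andP[].
    rewrite leNgt; apply/negP => /ltr_add_invr[k].
    have := tw k I; rewrite /F/= in_itv/= ltrBlDr => /andP[/lt_trans h _] /h.
    by rewrite ltxx.
  move=> dt n _; rewrite /F/= dt in_itv/= lexx andbT.
  by rewrite ltrBlDr ltrDl.
exists (t - n.+1%:R^-1); first by rewrite ltrBlDr ltrDl.
move=> t' nt sg j; apply: le_lt_trans (nP (sg, j)); apply: le_pr.
- exact: measurable_departure_itv.
- exact: measurable_departure_itv.
- by move=> w; rewrite /F /= !in_itv/= => /andP[/(le_lt_trans nt) -> ->].
Qed.

End Sampling.

(** * The exponential service law *)

Section ServiceLaw.
Context {R : realType} (mu : R) (mu_gt0 : 0 < mu).
Local Notation S := (service_law mu_gt0).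

Lemma pr_service_set1 x : pr S [set x] = 0.
Proof.
rewrite /pr [X in fine X](_ : _ = 0%E)//.
exact: integral_set1.
Qed.

Lemma pr_service_lt0 : pr S `]-oo, 0[%classic = 0.
Proof.
rewrite /pr [X in fine X](_ : _ = 0%E)//.
apply: integral0_eq => x /=; rewrite in_itv/= => x0.
by rewrite lt0_exponential_pdf.
Qed.

Lemma pr_service_itv0c x : 0 < x -> pr S `[0, x]%classic = 1 - expR (- mu * x).
Proof. by move=> x0; rewrite /pr [X in fine X]exponential_prob_itv0c. Qed.

Lemma pr_service_itvoo_gt0 a b : 0 <= a -> a < b -> 0 < pr S `]a, b[%classic.
Proof.
(* The middle third has positive endpoints, so its mass is a difference of two values of the formula
   for [[0, x]] with [0 < x]. *)
move=> a0 ab; pose c := a + (b - a) / 3; pose e := b - (b - a) / 3.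
have [ac ce eb] : [/\ a < c, c < e & e < b] by rewrite /c /e; split; lra.
apply: (@lt_le_trans _ _ (pr S `]c, e]%classic)); last first.
  apply: le_pr => // x /=; rewrite !in_itv/= => /andP[cx xe].
  by rewrite (lt_trans ac cx) (le_lt_trans xe eb).
have -> : pr S `]c, e]%classic = pr S `[0, e]%classic - pr S `[0, c]%classic.
  rewrite (@prID _ _ _ S `[0, e]%classic `[0, c]%classic)//.
  rewrite (_ : _ `&` _ = `[0, c]%classic); last first.
    apply/seteqP; split => x /=; rewrite !in_itv/=; first by case.
    by move=> /andP[-> xc]; rewrite xc (le_trans xc (ltW ce)).
  rewrite addrAC subrr add0r; congr pr; apply/seteqP; split => x /=;
    rewrite !in_itv/=.
    move=> /andP[cx ->].
    by rewrite ltW ?(le_lt_trans a0 (lt_trans ac cx))//= leNgt cx.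
  by move=> [/andP[-> ->]] /negP; rewrite -ltNge andbT.
rewrite !pr_service_itv0c; [|lra|lra].
suff : expR (- mu * e) < expR (- mu * c) by lra.
by rewrite ltr_expR !mulNr ltrN2 ltr_pM2l.
Qed.

Lemma pr_service_gt_gt0 t : 0 < pr S `]t, +oo[%classic.
Proof.
have u0 : 0 <= Num.max 0 t by rewrite le_max lexx.
apply: lt_le_trans (pr_service_itvoo_gt0 u0 (ltr_pwDr ltr01 (lexx _))) _.
apply: le_pr => // x /=; rewrite !in_itv/= andbT => /andP[+ _].
by rewrite gt_max => /andP[].
Qed.

(** Continuity at 0, where the law has no mass. The constant 1/2 matches the half of the atom that
    counts as ahead under random tie-breaking. *)
Lemma pr_service_gt_half : exists2 t, 0 < t & 1 / 2 < pr S `]t, +oo[%classic.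
Proof.
have [||||n] := @pr_bigcup_gt _ _ _ S
  (fun n => `]n.+1%:R^-1, +oo[%classic) (1 / 2) => //.
- move=> m n mn; apply/subsetPset => x /=; rewrite !in_itv/= !andbT.
  by apply: le_lt_trans; rewrite lef_pV2 ?posrE// ler_nat.
- rewrite (_ : \bigcup_n _ = ~` (`]-oo, 0[%classic `|` [set 0])).
    rewrite prC; last exact: measurableU.
    rewrite prU//; first by rewrite pr_service_lt0 pr_service_set1; lra.
    by apply/seteqP; split => // x [] /=;
      rewrite in_itv/= => + x0; rewrite x0 ltxx.
  apply/seteqP; split => x /=.
    move=> [n _]; rewrite /= in_itv/= andbT => nx.
    have x0 : 0 < x by apply: lt_trans nx; rewrite invr_gt0.
    by rewrite in_itv/= => -[|x00]; [rewrite ltNge ltW|rewrite x00 ltxx in x0].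
  rewrite in_itv/= => /not_orP[/negP + /eqP x0]; rewrite -leNgt le_eqVlt eq_sym.
  rewrite (negPf x0)/= => {}x0.
  have [k] := ltr_add_invr x0; rewrite add0r => kx; exists k => //=.
  by rewrite in_itv/= kx.
by move=> n2; exists n.+1%:R^-1; [rewrite invr_gt0|lra].
Qed.

End ServiceLaw.

(** * Expected numbers of customers *)

(** Composition with the transposition of [x] and [y] pairs the permutations so that exactly one of
    each pair ranks [x] first. *)
Lemma sum_perm_le {R : numFieldType} n (x y : 'I_n) : x != y ->
  \sum_(sg : 'S_n) (sg x <= sg y)%N%:R = #|{: 'S_n}|%:R / 2 :> R.
Proof.
move=> xy; set s := LHS.
have : s + s = #|{: 'S_n}|%:R.
  rewrite {2}/s (reindex_inj (mulgI (tperm x y))) /s -big_split/=.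
  rewrite -sum1_card natr_sum; apply: eq_bigr => sg _.
  rewrite !permM tpermL tpermR; case: ltngtP => [||/val_inj/perm_inj xy'].
  - by rewrite addr0.
  - by rewrite add0r.
  - by rewrite xy' eqxx in xy.
by move=> <-; field.
Qed.

Section MeanValues.
Context {R : realType} (N : nat) (mu : R) (mu_gt0 : 0 < mu).
Variable F : cumulativeBounded (0 : R) (1 : R).
Local Notation RB := (measurableTypeR R).
Local Notation A := (arrival_law F).
Local Notation S := (service_law mu_gt0).
Local Notation law := (joint_law N A S).
Local Notation mean := (mean_value mu_gt0 F).
Implicit Types (sg : 'S_N.+1) (j : 'I_N).

(** The mean is over permutations only; customers are summed, whence the factor [N] in
    [average_cst]. *)
Definition average (f : 'S_N.+1 -> 'I_N -> R) : R :=
  (\sum_sg \sum_j f sg j) / #|{: 'S_N.+1}|%:R.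

Let perms_gt0 : 0 < #|{: 'S_N.+1}|%:R :> R.
Proof. by rewrite ltr0n; apply/card_gt0P; exists 1%g. Qed.

Lemma le_average f g : (forall sg j, f sg j <= g sg j) ->
  average f <= average g.
Proof.
move=> fg; rewrite ler_pM2r ?invr_gt0//.
by apply: ler_sum => sg _; apply: ler_sum => j _.
Qed.

Lemma average_cst c : average (fun _ _ => c) = N%:R * c.
Proof.
rewrite /average !sumr_const card_ord -[_ *+ #|_|]mulr_natr mulfK ?gt_eqF//.
by rewrite mulr_natl.
Qed.

Lemma averageD f g :
  average (fun sg j => f sg j + g sg j) = average f + average g.
Proof.
rewrite /average -mulrDl -big_split/=; congr (_ / _).
by apply: eq_bigr => sg _; rewrite big_split.
Qed.

Lemma average_gt0 f : (forall sg, 0 < \sum_j f sg j) -> 0 < average f.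
Proof.
move=> f0; rewrite divr_gt0//; apply: (@lt_le_trans _ _ (\sum_j f 1%g j)) => //.
by rewrite (bigD1 (1%g : 'S_N.+1))//= lerDl sumr_ge0// => sg _; exact/ltW.
Qed.

Definition in_system t sg j : R :=
  pr law [set w | ahead sg t w j && (t < departure sg w j)].

Lemma mean_num_in_systemE t :
  mean (@num_in_system R N t) = average (in_system t).
Proof.
congr (_ / _); apply: eq_bigr => sg _.
apply: mean_count => [w|j]; [exact: num_in_systemE|exact: measurable_in_system].
Qed.

Lemma mean_num_aheadE t : mean (@num_ahead R N t) =
  average (fun sg j => pr law [set w | ahead sg t w j]).
Proof.
congr (_ / _); apply: eq_bigr => sg _.
apply: mean_count => [w|j]; first exact: num_aheadE.
by apply: measurable_fun_pred; exact: measurable_ahead.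
Qed.

(** A tie is lost with probability one half, which gives the factor 1/2 on the atom. *)
Lemma mean_num_ahead t : mean (@num_ahead R N t) =
  N%:R * (pr A `]-oo, t[%classic + atom F t / 2).
Proof.
rewrite mean_num_aheadE.
rewrite (_ : (fun sg j => _) = (fun sg j => pr A `]-oo, t[%classic +
    (sg (lift ord0 j) <= sg ord0)%N%:R * pr A [set t])); last first.
  by apply/funext => sg; apply/funext => j; rewrite pr_ahead.
rewrite averageD average_cst mulrDr; congr (_ + _).
rewrite /average exchange_big/=.
rewrite (eq_bigr (fun=> #|{: 'S_N.+1}|%:R / 2 * pr A [set t])) => [|j _].
  rewrite sumr_const card_ord -[_ *+ N]mulr_natl /atom -/(pr A _).
  by field; rewrite gt_eqF.
by rewrite -mulr_suml sum_perm_le// eq_sym neq_lift.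
Qed.

Lemma mean_num_in_system_ge t :
  N%:R * (pr A `]-oo, t[%classic * pr S `]t, +oo[%classic) <=
  mean (@num_in_system R N t).
Proof.
rewrite mean_num_in_systemE -average_cst; apply: le_average => sg j.
exact/pr_in_system_ge/pr_service_lt0.
Qed.

Lemma mean_num_in_system_le_ahead t :
  mean (@num_in_system R N t) <= mean (@num_ahead R N t).
Proof.
rewrite mean_num_in_systemE mean_num_aheadE; apply: le_average => sg j.
exact: pr_in_system_le.
Qed.

Lemma mean_num_in_system0 :
  mean (@num_in_system R N 0) = mean (@num_ahead R N 0).
Proof.
rewrite mean_num_in_systemE mean_num_aheadE; congr average.
apply/funext => sg; apply/funext => j; apply: pr_in_system0.
  exact: pr_service_set1.
exact: pr_service_lt0.
Qed.

Lemma mean_num_in_system_tail (e : R) : 0 < e -> exists u : R,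
  forall t, u <= t -> mean (@num_in_system R N t) <= e.
Proof.
(* The share [e / N.+1] is positive for every [N], and [N] shares add up to at most [e]. *)
move=> e0; have N1 : 0 < N.+1%:R :> R by [].
have [u uP] := @departure_tail _ N A S _ (divr_gt0 e0 N1).
exists u => t ut; rewrite mean_num_in_systemE.
apply: (@le_trans _ _ (N%:R * (e / N.+1%:R))).
  rewrite -average_cst; apply: le_average => sg j.
  apply: le_trans (ltW (uP _ ut sg j)); apply: le_pr.
  - exact: measurable_in_system.
  - exact: measurable_departure_gt.
  - by move=> w /= /andP[].
by rewrite mulrCA ler_piMr ?(ltW e0)// ler_pdivrMr// mul1r ler_nat.
Qed.

(** Whoever is present at [t'] is still present at [t] or departs in []t', t]], which is unlikely
    for [t'] close to [t]. *)
Lemma mean_num_in_system_left (t e : R) : 0 < e -> exists2 u : R, u < t &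
  forall t', u <= t' -> t' < t ->
    mean (@num_in_system R N t') <= mean (@num_in_system R N t) + e.
Proof.
move=> e0; have N1 : 0 < N.+1%:R :> R by [].
have [u ut uP] := @departure_left _ N A S (pr_service_set1 mu_gt0) t _
  (divr_gt0 e0 N1).
exists u => // t' ut' t't; rewrite !mean_num_in_systemE.
apply: (@le_trans _ _
  (average (in_system t) + N%:R * (e / N.+1%:R))); last first.
  by rewrite lerD2l mulrCA ler_piMr ?(ltW e0)// ler_pdivrMr// mul1r ler_nat.
rewrite -average_cst -averageD; apply: le_average => sg j.
apply: le_trans (lerD (lexx _) (ltW (uP _ ut' sg j))); apply: le_prD.
- exact: measurable_in_system.
- exact: measurable_in_system.
- exact: measurable_departure_itv.
move=> w /= /andP[at' t'w]; have [tw|wt] := ltP t (departure sg w j).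
  left; rewrite andbT; move: at'; rewrite /ahead => /orP[/lt_trans ->//|].
  by move=> /andP[/eqP ->]; rewrite t't.
by right; rewrite in_itv/= t'w.
Qed.

(** Without arrivals in the gap, those present at [s2] and those departing within the gap are
    disjoint groups, both present at [s1]. *)
Lemma mean_num_in_system_gap_le (s1 s2 : R) : s1 <= s2 ->
  pr A `[s1, s2]%classic = 0 ->
  average (fun sg j =>
    pr law [set w | (arr w j < s1) /\ departure sg w j \in `]s1, s2]]) +
    mean (@num_in_system R N s2) <=
  mean (@num_in_system R N s1).
Proof.
move=> s12 A0; rewrite !mean_num_in_systemE -averageD.
apply: le_average => sg j; set X := [set w | _ /\ _].
have mX : measurable X.
  apply: measurableI; last exact: measurable_departure_itv.
  by apply: measurable_fun_pred; apply: measurable_fun_ltr => //;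
    exact: measurable_arr.
have mI t := measurable_in_system sg t j.
have mZ : measurable [set w : N.-tuple (RB * RB) | `[s1, s2]%classic (arr w j)].
  rewrite -[X in measurable X]setTI.
  exact: (measurable_arr j measurableT (measurable_itv `[s1, s2])).
rewrite -prU//; last first.
  apply/seteqP; split => // w []; rewrite /X/= in_itv/= => -[_ /andP[_ ws2]].
  by move=> /andP[_]; rewrite ltNge ws2.
rewrite -[leRHS]addr0 -A0 -(pr_arr A S j)//; apply: le_prD => //.
  exact: measurableU.
move=> w [[/= ws1]|/= /andP[aw s2w]].
  by rewrite in_itv/= => /andP[s1w _]; left; rewrite s1w /ahead ws1.
have [ws1|s1w] := ltP (arr w j) s1.
  by left; rewrite (le_lt_trans s12 s2w) /ahead ws1.
right; rewrite in_itv/= s1w/=.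
by move: aw => /orP[/ltW//|/andP[/eqP ->]].
Qed.

Lemma mean_num_in_system_gap_lt (s1 s2 : R) : (0 < N)%N -> 0 <= s1 -> s1 < s2 ->
  pr A `[s1, s2]%classic = 0 ->
  (forall u, u < s1 -> 0 < pr A `]u, s1[%classic) ->
  mean (@num_in_system R N s2) < mean (@num_in_system R N s1).
Proof.
move=> N0 s10 s12 A0 Agt.
apply: lt_le_trans (mean_num_in_system_gap_le (ltW s12) A0).
rewrite ltrDr; apply: average_gt0 => sg.
pose d := (s2 - s1) / 2; have d0 : 0 < d by rewrite /d; lra.
(* If all arrive just before s1 and have service times in ]d, 2 d[, then the
   first customer leaves between s1 and s2. *)
pose B : 'I_N -> set (RB * RB) :=
  fun=> `]s1 - d, s1[%classic `*` `]d, 2 * d[%classic.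
have mB i : measurable (B i) by exact: measurableX.
have : 0 < pr law [set w | forall i, B i (tnth w i)].
  rewrite pr_box//; apply: prodr_gt0 => i _; rewrite pr_prod//.
  apply: mulr_gt0; first by apply: Agt; lra.
  by apply: pr_service_itvoo_gt0; lra.
pose X j := [set w : N.-tuple (RB * RB) |
  (arr w j < s1) /\ departure sg w j \in `]s1, s2]].
have mX j : measurable (X j).
  apply: measurableI; last exact: measurable_departure_itv.
  by apply: measurable_fun_pred; apply: measurable_fun_ltr => //;
    exact: measurable_arr.
move=> /lt_le_trans; apply.
(* Which customer is first depends on [w], so the event is covered by the union of all [X j]. *)
apply: le_trans (le_pr_bigsetU law (index_enum _) mX).
apply: le_pr; first exact: measurable_box.
  exact: bigsetU_measurable.
move=> w /= Bw; have [j jP] := exists_first sg w N0.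
rewrite (bigD1 j)//=; left; rewrite /X /= (departure_first jP).
have [] := Bw j; rewrite /= !in_itv/= -/(arr w j) -/(srv w j).
move=> /andP[a1 a2] /andP[b1 b2]; split => //.
have sd : s2 = s1 + 2 * d by rewrite /d; lra.
(* Service of [j] starts at [Num.max 0 (arr w j)], above [s1 - d] and, as [0 <= s1], not after [s1];
   it lasts between [d] and [2 * d]. *)
apply/andP; split; first by case: (leP 0 (arr w j)) => ?; lra.
by case: (leP 0 (arr w j)) => ?; lra.
Qed.

End MeanValues.

(** * Support of the arrival law *)

Section Support.
Context {R : realType} (F : cumulativeBounded (0 : R) (1 : R)).
Local Notation RB := (measurableTypeR R).
Local Notation A := (arrival_law F).
Local Notation supp := (arrival_support F).

Lemma arrival_supportP (t : R) :
  supp t <-> forall e, 0 < e -> 0 < pr A `]t - e, t + e[%classic.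
Proof.
split => [st e e0|st U [oU Ut]].
  rewrite -lte_fin -prE//; apply: st; split; first exact: itv_open.
  by rewrite /= in_itv/=; apply/andP; split; lra.
have /nbhs_ballP[e /= e0 eU] := open_nbhs_nbhs (conj oU Ut).
apply: (@lt_le_trans _ _ (A `]t - e, t + e[%classic)).
  by rewrite prE// lte_fin; exact: st.
apply: le_measure; rewrite ?inE//; first exact: open_measurable.
by rewrite -ball_itv.
Qed.

Lemma arrival_support_sup_itv (a b t : R) :
  supp t -> a < t < b -> 0 < pr A `]a, b[%classic.
Proof.
move=> /arrival_supportP st /andP[at1 tb].
have e0 : 0 < Num.min (t - a) (b - t) by rewrite lt_min !subr_gt0 at1.
apply: lt_le_trans (st _ e0) _; apply: le_pr => // x /=; rewrite !in_itv/=.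
have e1 : Num.min (t - a) (b - t) <= t - a by rewrite ge_min lexx.
have e2 : Num.min (t - a) (b - t) <= b - t by rewrite ge_min lexx orbT.
by move=> /andP[x1 x2]; apply/andP; split; lra.
Qed.

(** Each point outside the support lies in a null interval with rational endpoints, and there are
    countably many of these. *)
Lemma pr_support_null (B : set RB) : measurable B ->
  (forall t, B t -> ~ supp t) -> pr A B = 0.
Proof.
move=> mB Bs.
pose I (q : rat * rat) : set RB := `]ratr q.1, ratr q.2[%classic.
(* An enumeration of the null rational intervals; all other codes give the empty set. *)
pose G n : set RB := if unpickle n is Some q then
  (if pr A (I q) == 0 then I q else set0) else set0.
have mI q : measurable (I q) by exact: measurable_itv.
have mG n : measurable (G n).
  by rewrite /G; case: unpickle => // q; case: ifP.
have G0 n : pr A (G n) = 0.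
  rewrite /G; case: unpickle => [q|]; last exact: pr0.
  by have [|_] := eqVneq (pr A (I q)) 0; last exact: pr0.
apply/eqP; rewrite eq_le pr_ge0 andbT -(pr_bigcup_null mG G0).
apply: le_pr => //; first exact: bigcup_measurable.
move=> t /Bs/arrival_supportP/existsNP[e /not_implyP[e0 /negP]].
rewrite -leNgt => te.
have [a] := @rat_in_itvoo R (t - e) t ltac:(lra).
have [b] := @rat_in_itvoo R t (t + e) ltac:(lra).
rewrite !in_itv/= => /andP[tb be] /andP[ea at1].
have [n nE] : exists n, unpickle n = Some (a, b).
  by exists (pickle (a, b)); rewrite pickleK.
exists n; rewrite // /G nE.
have -> : pr A (I (a, b)) == 0; last by rewrite /I /= in_itv/= at1.
rewrite eq_le pr_ge0 andbT; apply: le_trans te; apply: le_pr => // x /=.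
rewrite /I /= !in_itv/= => /andP[ax xb].
by rewrite (lt_trans ea ax) (lt_trans xb be).
Qed.

Lemma arrival_support_neq0 : exists t, supp t.
Proof.
apply: contrapT => /forallNP s0.
by have := prT A; rewrite pr_support_null// => /eqP; rewrite eq_sym oner_eq0.
Qed.

(** The support is closed, so the infimum of its part above [a] belongs to it. *)
Lemma arrival_support_min (a z : R) : supp z -> a <= z -> exists m,
  [/\ supp m, a <= m & forall t, supp t -> a <= t -> m <= t].
Proof.
move=> sz az; pose E : set R := [set t | supp t /\ a <= t].
have Ez : E z by [].
have infE : has_inf E by split; [exists z|exists a => t []].
exists (inf E); split.
- apply/arrival_supportP => e e0.
  have [t [st at1] te] := inf_adherent e0 infE.
  apply: (arrival_support_sup_itv st).
  by rewrite te andbT (lt_le_trans (_ : _ < inf E)) ?ltrBlDr ?ltrDl// ge_inf//;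
    exists a => ? [].
- by apply: lb_le_inf; [exists z|move=> t []].
- by move=> t st at1; apply: ge_inf; [exists a => ? []|].
Qed.

Lemma arrival_support_max (b z : R) : supp z -> z <= b -> exists m,
  [/\ supp m, m <= b & forall t, supp t -> t <= b -> t <= m].
Proof.
move=> sz zb; pose E : set R := [set t | supp t /\ t <= b].
have Ez : E z by [].
have supE : has_sup E by split; [exists z|exists b => t []].
exists (sup E); split.
- apply/arrival_supportP => e e0.
  have [t [st tb] te] := sup_adherent e0 supE.
  apply: (arrival_support_sup_itv st).
  by rewrite te/= (le_lt_trans (_ : _ <= sup E)) ?ltrDl// ub_le_sup//;
    exists b => ? [].
- by apply: ge_sup; [exists z|move=> t []].
- by move=> t st tb; apply: ub_le_sup; [exists b => ? []|].
Qed.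

Lemma pr_itvNyo t : pr A `]-oo, t]%classic = pr A `]-oo, t[%classic + atom F t.
Proof.
rewrite -[atom F t]/(pr A [set t]) -prU//.
  congr pr; apply/seteqP; split => x /=; rewrite !in_itv/= le_eqVlt.
    by move=> /predU1P[->|]; [right|left].
  by move=> [->|->]; rewrite ?eqxx ?orbT.
by apply/seteqP; split => // x [] /=; rewrite in_itv/= => + xt; rewrite xt ltxx.
Qed.

End Support.

(** * Cost of an arrival time *)

Section Cost.
Context {R : realType} (N : nat) (alpha gamma mu : R) (mu_gt0 : 0 < mu).
Hypotheses (N_gt0 : (0 < N)%N) (alpha_gt0 : 0 < alpha) (gamma_gt0 : 0 < gamma).
Variable F : cumulativeBounded (0 : R) (1 : R).
Local Notation RB := (measurableTypeR R).
Local Notation A := (arrival_law F).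
Local Notation S := (service_law mu_gt0).
Local Notation supp := (arrival_support F).
Local Notation mean := (mean_value mu_gt0 F).
Local Notation Q t := (mean (@num_in_system R N t)).
Local Notation c := (cost N alpha gamma mu_gt0 F).

Definition earliness_cost (t : R) : R := if t < 0 then - alpha * t else 0.

Let am_gt0 : 0 < alpha / mu. Proof. exact: divr_gt0. Qed.
Let Nr_gt0 : 0 < N%:R :> R. Proof. by rewrite ltr0n. Qed.

Lemma earliness_cost_ge0 t : 0 <= earliness_cost t.
Proof.
rewrite /earliness_cost; case: ltP => // t0.
by rewrite mulNr oppr_ge0 pmulr_rle0// ltW.
Qed.

Lemma earliness_cost_ge t : - alpha * t <= earliness_cost t.
Proof.
rewrite /earliness_cost; case: ltP => // t0.
by rewrite mulNr oppr_le0 pmulr_rge0.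
Qed.

Lemma earliness_cost_lip s t : s <= t ->
  earliness_cost s <= earliness_cost t + alpha * (t - s).
Proof.
move=> st; have := earliness_cost_ge t; have := earliness_cost_ge0 t.
rewrite {3}/earliness_cost; case: ltP => s0 t1 t2; first by lra.
by rewrite addr_ge0// mulr_ge0 ?subr_ge0// ltW.
Qed.

Lemma earliness_cost_nonincreasing s t : s <= t ->
  earliness_cost t <= earliness_cost s.
Proof.
move=> st; rewrite {1}/earliness_cost; case: ltP => t0.
  by rewrite /earliness_cost (le_lt_trans st t0) !mulNr lerN2 ler_pM2l.
exact: earliness_cost_ge0.
Qed.

Lemma costE t : c t = earliness_cost t + alpha / mu * Q t +
  gamma * (N%:R * (pr A `]-oo, t[%classic + atom F t / 2)).
Proof. by rewrite /cost mean_num_ahead. Qed.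

Let Q_ge0 t : 0 <= Q t.
Proof.
apply: le_trans (mean_num_in_system_ge _ _ _ t).
by rewrite !mulr_ge0 ?pr_ge0.
Qed.

Lemma pr_lt_atom_le1 t : pr A `]-oo, t[%classic + atom F t <= 1.
Proof. by rewrite -pr_itvNyo pr_le1. Qed.

Lemma atom_ge0 t : 0 <= atom F t.
Proof. exact: pr_ge0. Qed.

Lemma cost_ge_earliness t : - alpha * t <= c t.
Proof.
apply: le_trans (earliness_cost_ge t) _; rewrite costE -addrA lerDl.
apply: addr_ge0; first by rewrite mulr_ge0// ltW.
by rewrite !mulr_ge0 ?addr_ge0 ?divr_ge0 ?pr_ge0 ?atom_ge0// ltW.
Qed.

Lemma cost_ge t : gamma * (N%:R * pr A `]-oo, t[%classic) +
  alpha / mu * (N%:R * (pr A `]-oo, t[%classic * pr S `]t, +oo[%classic)) <=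
  c t.
Proof.
rewrite costE addrC; apply: lerD.
  rewrite -[leLHS]add0r; apply: lerD; first exact: earliness_cost_ge0.
  by rewrite ler_pM2l// mean_num_in_system_ge.
rewrite ler_pM2l// ler_pM2l// lerDl divr_ge0//; exact: atom_ge0.
Qed.

(** A very late customer finds an almost empty system and has at most [N] customers ahead. *)
Lemma equilibrium_cost_le ce : (forall t, 0 <= t -> ce <= c t) ->
  ce <= N%:R * gamma.
Proof.
move=> cet; apply/ler_addgt0Pr => e e0.
have e1 : 0 < e / (alpha / mu) by rewrite divr_gt0.
have [u uP] := mean_num_in_system_tail N mu_gt0 F e1.
have t0 : 0 <= Num.max u 0 by rewrite le_max lexx orbT.
apply: le_trans (cet _ t0) _; rewrite costE {1}/earliness_cost ltNge t0 add0r.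
rewrite addrC; apply: lerD.
  rewrite [leRHS]mulrC ler_pM2l// -[leRHS]mulr1 ler_pM2l//.
  have := pr_lt_atom_le1 (Num.max u 0); have := atom_ge0 (Num.max u 0); lra.
rewrite -ler_pdivlMl// mulrC; apply: uP.
by rewrite le_max lexx.
Qed.

(* Arriving just before an atom saves the ties but costs almost the same waiting
   time. *)
Lemma cost_before_atom u t : 0 < atom F t -> u < t ->
  exists t', [/\ u <= t', t' < t & c t' < c t].
Proof.
(* [k] is the expected cost of the ties at [t]. Earliness and waiting may each lose [k / 4], so
   [k / 2] is still gained. *)
move=> pt ut; pose k := gamma * (N%:R * (atom F t / 2)).
have k0 : 0 < k by rewrite !mulr_gt0// invr_gt0.
have e0 : 0 < k / 4 / (alpha / mu) by rewrite !divr_gt0.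
have [v vt vP] := mean_num_in_system_left N mu_gt0 F t e0.
pose t' := Num.max (Num.max u v) (t - k / 4 / alpha).
have ut' : u <= t' by rewrite !le_max lexx.
have vt' : v <= t' by rewrite !le_max lexx orbT.
have kt' : t - k / 4 / alpha <= t' by rewrite !le_max lexx orbT.
have t't : t' < t by rewrite !gt_max ut vt ltrBlDr ltrDl !divr_gt0.
exists t'; split => //; rewrite !costE.
have h1 := earliness_cost_lip (ltW t't).
have h2 : alpha * (t - t') <= k / 4.
  by rewrite -ler_pdivlMl// mulrC lerBlDr -lerBlDl.
have h3 : alpha / mu * Q t' <= alpha / mu * Q t + k / 4.
  have -> : k / 4 = alpha / mu * (k / 4 / (alpha / mu)).
    by rewrite [RHS]mulrC divfK// gt_eqF.
  by rewrite -mulrDr ler_pM2l//; exact: vP.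
have h4 : gamma * (N%:R * (pr A `]-oo, t'[%classic + atom F t' / 2)) <=
    gamma * (N%:R * pr A `]-oo, t[%classic).
  rewrite ler_pM2l// ler_pM2l//.
  apply: (@le_trans _ _ (pr A `]-oo, t']%classic)).
    by rewrite pr_itvNyo lerD2l; have := atom_ge0 t'; lra.
  by apply: le_pr => // x /=; rewrite !in_itv/= => /le_lt_trans; exact.
rewrite [X in _ < _ + gamma * X]mulrDr mulrDr -/k; lra.
Qed.

Lemma pr_left_of_gap s1 s2 : supp s1 -> s1 < s2 ->
  pr A `[s1, s2]%classic = 0 -> forall u, u < s1 -> 0 < pr A `]u, s1[%classic.
Proof.
move=> ss1 s12 A0 u us1.
have ust : u < s1 < s2 by rewrite us1.
apply: lt_le_trans (arrival_support_sup_itv ss1 ust) _.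
rewrite -[leRHS]addr0 -A0; apply: le_prD => // x /=; rewrite !in_itv/=.
by move=> /andP[ux xs2]; case: (ltP x s1) => xs1;
  [left; rewrite ux|right; rewrite ltW].
Qed.

(** Waiting through the gap lets nobody else get ahead. If [s1 < 0] the earliness cost strictly
    drops; otherwise the queue strictly shrinks in mean. *)
Lemma cost_gap s1 s2 : supp s1 -> s1 < s2 -> pr A `[s1, s2]%classic = 0 ->
  c s2 < c s1.
Proof.
move=> ss1 s12 A0.
have atom0 s : s1 <= s <= s2 -> atom F s = 0.
  move=> sE; apply/eqP; rewrite eq_le atom_ge0 andbT -A0; apply: le_pr => //.
  by move=> x /= ->; rewrite in_itv.
have p1 := atom0 s1 ltac:(by rewrite lexx ltW).
have p2 := atom0 s2 ltac:(by rewrite lexx ltW).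
have m12 : pr A `]-oo, s2[%classic <= pr A `]-oo, s1[%classic.
  rewrite -[leRHS]addr0 -A0; apply: le_prD => // x /=; rewrite !in_itv/=.
  by move=> xs2; case: (ltP x s1) => xs1; [left|right; rewrite ltW].
have h3 : gamma * (N%:R * pr A `]-oo, s2[%classic) <=
   gamma * (N%:R * pr A `]-oo, s1[%classic) by rewrite !ler_pM2l.
rewrite !costE p1 p2 mul0r !addr0; apply: ltr_leD => //.
have [s10|s10] := ltP s1 0.
  apply: ltr_leD.
    rewrite /earliness_cost s10; have [s20|s20] := ltP s2 0.
      by rewrite !mulNr ltrN2 ltr_pM2l.
    by rewrite mulNr oppr_gt0 pmulr_rlt0.
  rewrite ler_pM2l//.
  apply: le_trans (mean_num_in_system_gap_le N mu_gt0 (ltW s12) A0).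
  rewrite lerDr; apply: le_trans (le_average (f := fun _ _ => 0) _).
    by rewrite average_cst mulr0.
  by move=> sg j; exact: pr_ge0.
apply: ler_ltD; first exact: earliness_cost_nonincreasing (ltW s12).
rewrite ltr_pM2l//; apply: mean_num_in_system_gap_lt => //.
exact: pr_left_of_gap ss1 s12 A0.
Qed.

Lemma cost0 : pr A `]-oo, 0[%classic = 0 ->
  c 0 = (alpha / mu + gamma) * (N%:R * (atom F 0 / 2)).
Proof.
move=> A0; rewrite costE mean_num_in_system0 mean_num_ahead A0 add0r.
by rewrite /earliness_cost ltxx add0r mulrDl.
Qed.

Lemma cost_first t : pr A `]-oo, t]%classic = 0 -> c t = earliness_cost t.
Proof.
move=> A0; have := pr_itvNyo F t; have := atom_ge0 t.
have := pr_ge0 A `]-oo, t[%classic; rewrite A0 => m0 p0 mp.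
have [m1 p1] : pr A `]-oo, t[%classic = 0 /\ atom F t = 0 by split; lra.
have QE : Q t = 0.
  apply/eqP; rewrite eq_le Q_ge0 andbT.
  apply: le_trans (mean_num_in_system_le_ahead _ _ _ _) _.
  by rewrite mean_num_ahead m1 p1 mul0r addr0 mulr0.
by rewrite costE QE m1 p1 mul0r !addr0 !mulr0 !addr0.
Qed.

(** All others are ahead almost surely, and exponential services exceed [b] with positive
    probability. *)
Lemma cost_last b : (forall t, supp t -> t <= b) -> atom F b = 0 ->
  N%:R * gamma < c b.
Proof.
move=> sb p0.
have m1 : pr A `]-oo, b[%classic = 1.
  rewrite -[LHS]addr0 -p0 -pr_itvNyo -[LHS]addr0.
  rewrite -(@pr_support_null _ F `]b, +oo[%classic)//; last first.
    by move=> t; rewrite /= in_itv/= andbT => bt /sb; rewrite leNgt bt.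
  by rewrite -setCitvl prC// addrC subrK.
apply: lt_le_trans (cost_ge b); rewrite m1 mulr1 mul1r [gamma * _]mulrC ltrDl.
by do 2!apply: mulr_gt0 => //; exact: pr_service_gt_gt0.
Qed.

(** At far points of the support almost all others are ahead, so the order cost alone approaches
    [N%:R * gamma]. *)
Lemma unbounded_support_cost ce : (forall t, supp t -> c t = ce) ->
  (forall M, exists2 t, supp t & M < t) -> N%:R * gamma <= ce.
Proof.
move=> cet unb; apply/ler_addgt0Pr => e e0.
have e1 : 0 < e / (N%:R * gamma) by rewrite divr_gt0// mulr_gt0.
have [||||n nP] := @pr_bigcup_gt _ _ _ A (fun n => `]-oo, n%:R[%classic)
  (e / (N%:R * gamma)) => //.
- move=> k n kn; apply/subsetPset => x /=; rewrite !in_itv/= => /lt_le_trans.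
  by apply; rewrite ler_nat.
- rewrite -[RHS](prT A); congr pr; apply/seteqP; split => // x _.
  by exists (Num.truncn (x : R)).+1; rewrite //= in_itv/=; exact: truncnS_gt.
have [t st nt] := unb n%:R; rewrite -lerBlDr -(cet _ st).
have mt : pr A `]-oo, n%:R[%classic <= pr A `]-oo, t[%classic.
  by apply: le_pr => // x /=; rewrite !in_itv/= => /lt_trans; exact.
apply: le_trans (cost_ge t); rewrite -[leLHS]addr0; apply: lerD; last first.
  by rewrite !mulr_ge0 ?pr_ge0 ?invr_ge0// ltW.
rewrite mulrA [gamma * _]mulrC.
have Ng0 : 0 < N%:R * gamma by rewrite mulr_gt0.
apply: (@le_trans _ _ (N%:R * gamma * (1 - e / (N%:R * gamma)))).
  by rewrite mulrBr mulr1 [X in _ <= _ - X]mulrC divfK// gt_eqF.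
by rewrite ler_pM2l//; exact: le_trans (ltW nP) mt.
Qed.

Section EqualCost.
Variables (a ce : R).
Hypothesis no_atom : forall t, supp t -> a <= t -> atom F t = 0.
Hypothesis cost_supp : forall t, supp t -> c t = ce.

(** A missing [z] lies in a gap whose ends are in the support and carry no atom, and [cost_gap]
    contradicts equal cost at these ends. Excluding atoms only from [a] on leaves room for the atom
    at 0. *)
Lemma support_convex x y z : supp x -> supp y -> a <= x -> x <= z -> z <= y ->
  supp z.
Proof.
move=> sx sy ax xz zy; apply: contrapT => sz.
have [s1 [ss1 s1z s1max]] := arrival_support_max sx xz.
have [s2 [ss2 zs2 s2min]] := arrival_support_min sy zy.
have {}s1z : s1 < z.
  by rewrite lt_neqAle s1z andbT; apply: contra_notN sz => /eqP <-.
have {}zs2 : z < s2.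
  by rewrite lt_neqAle zs2 andbT; apply: contra_notN sz => /eqP ->.
have s12 := lt_trans s1z zs2.
have as1 : a <= s1 by apply: le_trans (s1max _ sx xz).
have gap : pr A `]s1, s2[%classic = 0.
  apply: pr_support_null => // t; rewrite /= in_itv/= => /andP[s1t ts2] st.
  have [tz|zt] := leP t z.
    by have := s1max _ st tz; rewrite leNgt s1t.
  by have := s2min _ st (ltW zt); rewrite leNgt ts2.
have gap' : pr A `[s1, s2]%classic = 0.
  apply/eqP; rewrite eq_le pr_ge0 andbT.
  have <- : pr A `]s1, s2[%classic + atom F s1 + atom F s2 = 0.
    by rewrite gap !no_atom// ?addr0// (le_trans as1)// ltW.
  apply: (@le_trans _ _ (pr A (`]s1, s2[%classic `|` [set s1]) + atom F s2)).
    apply: le_prD => //; first exact: measurableU.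
    move=> t /=; rewrite !in_itv/= => /andP[s1t ts2].
    have [->|ts1] := eqVneq t s1; first by left; right.
    have [->|ts2'] := eqVneq t s2; first by right.
    by left; left; rewrite !lt_neqAle s1t ts2 ts2' eq_sym ts1.
  by rewrite lerD2r le_prU.
by have := cost_gap ss1 s12 gap'; rewrite !cost_supp// ltxx.
Qed.

Lemma support_unbounded x : supp x -> a <= x -> ce <= N%:R * gamma ->
  forall M, exists2 t, supp t & M < t.
Proof.
move=> sx ax ce_le M; apply: contrapT => bnd.
have leM t : supp t -> t <= M.
  by move=> st; rewrite leNgt; apply/negP => Mt; apply: bnd; exists t.
have [b [sb bM bmax]] := arrival_support_max sx (leM _ sx).
have := @cost_last b; rewrite cost_supp// ltNge ce_le => /(_ _ _)/negP.
by apply => //; [move=> t st; exact: bmax (leM _ st)|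
  apply: no_atom => //; exact: le_trans (bmax _ sx (leM _ sx))].
Qed.

End EqualCost.

End Cost.

(** * Equilibria *)

Section Equilibrium.
Context {R : realType} (N : nat) (alpha gamma mu : R) (mu_gt0 : 0 < mu).
Hypotheses (N_gt0 : (0 < N)%N) (alpha_gt0 : 0 < alpha) (gamma_gt0 : 0 < gamma).
Variables (F : cumulativeBounded (0 : R) (1 : R)) (ce : R).
Local Notation RB := (measurableTypeR R).
Local Notation A := (arrival_law F).
Local Notation S := (service_law mu_gt0).
Local Notation supp := (arrival_support F).
Local Notation c := (cost N alpha gamma mu_gt0 F).

Let Ng_gt0 : 0 < N%:R * gamma.
Proof. by rewrite mulr_gt0// ltr0n. Qed.

Lemma support_ray a m : supp m -> a <= m ->
  (forall t, supp t -> a <= t -> atom F t = 0) ->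
  (forall t, supp t -> c t = ce) -> ce <= N%:R * gamma ->
  forall t, m <= t -> supp t.
Proof.
move=> sm am no_atom cost_supp ce_le t mt.
have [b sb tb] := support_unbounded N_gt0 alpha_gt0 gamma_gt0 no_atom cost_supp
  sm am ce_le t.
exact: (support_convex N_gt0 alpha_gt0 gamma_gt0 no_atom cost_supp
  sm sb am mt (ltW tb)).
Qed.

Lemma equilibrium_early :
  symmetric_equilibrium N alpha gamma mu_gt0 setT F ce ->
  exists ta : R, [/\ ta < 0, supp = `[ta, +oo[%classic, ce = N%:R * gamma &
    ta = - (N%:R * (gamma / alpha))].
Proof.
move=> [_ _ cost_supp cost_ge_ce].
have ce_le : ce <= N%:R * gamma.
  apply: (equilibrium_cost_le N_gt0 alpha_gt0 gamma_gt0
    (mu_gt0 := mu_gt0) (F := F)) => t _.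
  exact: cost_ge_ce.
have no_atom t : supp t -> atom F t = 0.
  move=> st; apply/eqP; rewrite eq_le pr_ge0 andbT leNgt; apply/negP => pt.
  have t1 : t - 1 < t by rewrite ltrBlDr ltrDl.
  have [t' [_ _]] := cost_before_atom mu_gt0 N_gt0 alpha_gt0 gamma_gt0 pt t1.
  by rewrite ltNge cost_supp// cost_ge_ce.
have no_atom_from a t : supp t -> a <= t -> atom F t = 0.
  by move=> st _; exact: no_atom.
have [z sz] := arrival_support_neq0 F.
(* The earliness cost alone is at most [ce] on the support, so the support is bounded below and has
   a first point. *)
have lb t : supp t -> - (ce / alpha) <= t.
  move=> st; have := cost_ge_earliness N mu_gt0 alpha_gt0 gamma_gt0 F t.
  by rewrite cost_supp// lerNl ler_pdivlMr// !mulNr [t * _]mulrC.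
have [ta [sta _ ta_min]] := arrival_support_min sz (lb _ sz).
have ce_eq : ce = N%:R * gamma.
  apply/eqP; rewrite eq_le ce_le/=.
  apply: (unbounded_support_cost N_gt0 alpha_gt0 gamma_gt0 cost_supp).
  exact: (support_unbounded N_gt0 alpha_gt0 gamma_gt0
    (no_atom_from z) cost_supp sz (lexx z) ce_le).
have A0 : pr A `]-oo, ta]%classic = 0.
  rewrite pr_itvNyo no_atom// addr0; apply: pr_support_null => // t.
  rewrite /= in_itv/= => tta st.
  by have := ta_min _ st (lb _ st); rewrite leNgt tta.
(* The first customer pays for earliness only; [0 <= ta] would make the equilibrium cost 0. *)
have := cost_first N alpha gamma mu_gt0 A0.
rewrite cost_supp// /earliness_cost ce_eq; case: ltP => ta0 taE; last first.
  by have := Ng_gt0; rewrite taE ltxx.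
exists ta; split => //.
- apply/seteqP; split => t /=; rewrite in_itv/= andbT.
    by move=> st; exact: ta_min (lb _ st).
  exact: (support_ray sta (lexx ta) (no_atom_from ta)).
- by rewrite mulrA taE mulNr mulNr opprK mulrAC divff ?gt_eqF// mul1r.
Qed.

Lemma equilibrium_nonneg :
  symmetric_equilibrium N alpha gamma mu_gt0 `[0, +oo[%classic F ce ->
  [/\ 0 < atom F 0,
      atom F 0 = (if gamma < alpha / mu
                  then 2 * gamma / (gamma + alpha / mu) else 1),
      ce <= N%:R * gamma &
      atom F 0 < 1 ->
        exists te : R, 0 < te /\ supp `\ 0 = `[te, +oo[%classic].
Proof.
move=> [_ supp_ge0 cost_supp cost_ge_ce].
have am_gt0 : 0 < alpha / mu by exact: divr_gt0.
have {}supp_ge0 t : supp t -> 0 <= t.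
  by move=> /supp_ge0; rewrite /= in_itv/= andbT.
have {}cost_ge_ce t : 0 <= t -> ce <= c t.
  by move=> t0; apply: cost_ge_ce; rewrite /= in_itv/= t0.
have ce_le : ce <= N%:R * gamma.
  exact: (equilibrium_cost_le N_gt0 alpha_gt0 gamma_gt0 cost_ge_ce).
have no_atom t : supp t -> 0 < t -> atom F t = 0.
  move=> st t0; apply/eqP; rewrite eq_le pr_ge0 andbT leNgt; apply/negP => pt.
  have [t' [t'0 _]] := cost_before_atom mu_gt0 N_gt0 alpha_gt0 gamma_gt0 pt t0.
  by rewrite ltNge cost_supp// cost_ge_ce.
have A0 : pr A `]-oo, 0[%classic = 0.
  apply: pr_support_null => // t; rewrite /= in_itv/= => t0 /supp_ge0.
  by rewrite leNgt t0.
have c0 := cost0 N alpha gamma mu_gt0 A0.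
set p := atom F 0 in c0 *.
have p1 : p <= 1 by exact: pr_le1.
have supp0 : 0 < p -> supp 0.
  move=> p0; apply/arrival_supportP => e e0; apply: lt_le_trans p0 _.
  apply: le_pr => // t /= ->; rewrite in_itv/=; apply/andP; split; lra.
have Nr_gt0 : 0 < N%:R :> R by rewrite ltr0n.
have [p1'|p1'] := eqVneq p 1.
  have p0 : 0 < p by rewrite p1'.
  rewrite p1'; split => //; last by rewrite ltxx.
  (* With everyone at 0 the cost is [(alpha / mu + gamma) * N / 2], and the bound [N * gamma] on it
     is this inequality. *)
  suff : alpha / mu <= gamma by rewrite leNgt => /negPf ->.
  move: ce_le; rewrite -(cost_supp _ (supp0 p0)) c0 p1' mulrC -mulrA ler_pM2l//.
  lra.
have {p1'}p1' : p < 1 by rewrite lt_neqAle p1' p1.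
(* Some mass lies after 0; from [z] on there are no atoms, so the results on unbounded support
   apply. *)
have [z sz z0] : exists2 z, supp z & 0 < z.
  apply: contrapT => noz.
  have : pr A `]0, +oo[%classic = 0.
    apply: pr_support_null => // t; rewrite /= in_itv/= andbT => t0 st.
    by apply: noz; exists t.
  rewrite -setCitvl prC// pr_itvNyo A0 add0r -/p; lra.
have z_atom t : supp t -> z <= t -> atom F t = 0.
  by move=> st zt; apply: no_atom => //; exact: lt_le_trans zt.
have ce_eq : ce = N%:R * gamma.
  apply/eqP; rewrite eq_le ce_le/=.
  apply: (unbounded_support_cost N_gt0 alpha_gt0 gamma_gt0 cost_supp).
  exact: (support_unbounded N_gt0 alpha_gt0 gamma_gt0 z_atom cost_supp
    sz (lexx z) ce_le).
(* Without an atom at 0, arriving at 0 would be free. *)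
have p0 : 0 < p.
  rewrite lt_def pr_ge0 andbT; apply/eqP => p00.
  have := cost_ge_ce 0 (lexx 0); rewrite c0 p00 mul0r !mulr0 ce_eq.
  by rewrite leNgt Ng_gt0.
(* The atom puts 0 in the support, so [c 0] equals [N * gamma]. *)
have pE : (alpha / mu + gamma) * (p / 2) = gamma.
  apply: (@mulfI _ N%:R); first by rewrite gt_eqF.
  by rewrite -ce_eq -(cost_supp _ (supp0 p0)) c0 mulrCA.
have g_lt : gamma < alpha / mu.
  rewrite ltNge; apply/negP => amg.
  have : (alpha / mu + gamma) * (p / 2) < (alpha / mu + gamma) * (1 / 2).
    by rewrite ltr_pM2l ?addr_gt0// ltr_pM2r.
  rewrite pE; lra.
split => //.
  have ag0 : gamma + alpha / mu != 0 by rewrite gt_eqF// addr_gt0.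
  rewrite g_lt; apply: (mulIf ag0); rewrite divfK//.
  by rewrite -[X in _ = 2 * X]pE; field; rewrite gt_eqF.
(* At 0 half of the atom counts as ahead. For [0 < t < d] all of it does, and each such customer is
   still present with probability above 1/2, so the cost exceeds [N * (alpha / mu + gamma) * p / 2],
   which is [ce]. *)
move=> _; have [d d0 dS] := pr_service_gt_half mu_gt0.
have gap t : supp t -> 0 < t -> d <= t.
  move=> st t0; rewrite leNgt; apply/negP => td.
  have := cost_ge mu_gt0 N_gt0 alpha_gt0 gamma_gt0 F t.
  rewrite cost_supp// ce_eq leNgt => /negP; apply.
  have mt : p <= pr A `]-oo, t[%classic.
    by apply: le_pr => // x /= ->; rewrite in_itv.
  have St : 1 / 2 < pr S `]t, +oo[%classic.
    apply: lt_le_trans dS _; apply: le_pr => // x /=; rewrite !in_itv/= !andbT.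
    exact: lt_trans.
  set m := pr A _ in mt *; set s := pr S _ in St *.
  have h1 : gamma * (N%:R * p) <= gamma * (N%:R * m) by rewrite !ler_pM2l.
  have h2 : alpha / mu * (N%:R * (p * (1 / 2))) <=
      alpha / mu * (N%:R * (m * s)).
    by rewrite !ler_pM2l// ler_pM// ltW.
  have h3 : 0 < gamma * (N%:R * p) by rewrite !mulr_gt0.
  rewrite -{1}pE; move: h1 h2 h3; nra.
have [te [ste dte te_min]] := arrival_support_min sz (gap _ sz z0).
have te0 := lt_le_trans d0 dte.
have te_atom t : supp t -> te <= t -> atom F t = 0.
  by move=> st tet; apply: no_atom => //; exact: lt_le_trans tet.
exists te; split => //; apply/seteqP; split => t /=; rewrite in_itv/= andbT.
  move=> [st /eqP t0]; apply: te_min => //; apply: gap => //.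
  by rewrite lt_def t0 supp_ge0.
move=> tet; split; last by apply/eqP; rewrite gt_eqF// (lt_le_trans te0).
exact: (support_ray ste (lexx te) te_atom).
Qed.

End Equilibrium.

(** * The point mass at time 0 as an equilibrium attaining the bound *)

Section PointMass.
Context {R : realType}.
Local Notation RB := (measurableTypeR R).

Definition heaviside (x : R) : R := if 0 <= x then 1 else 0.

Let heaviside_nd : nondecreasing heaviside.
Proof.
move=> x y xy; rewrite /heaviside; case: (leP 0 x) => x0.
  by rewrite (le_trans x0 xy).
by case: ifP.
Qed.

Let heaviside_rc : right_continuous heaviside.
Proof.
move=> x; apply: cvg_near_cst; have [x0|x0] := leP 0 x.
  near=> y; have xy : x < y by near: y; exact: nbhs_right_gt.
  by rewrite /heaviside x0 (le_trans x0 (ltW xy)).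
near=> y; rewrite /heaviside [0 <= x]leNgt x0 leNgt; have -> // : y < 0.
by near: y; exact: nbhs_right_lt.
Unshelve. all: by end_near. Qed.

HB.instance Definition _ :=
  isCumulative.Build R _ R heaviside heaviside_nd heaviside_rc.

Let heaviside_Ny : heaviside @ -oo --> (0 : R).
Proof.
apply: cvg_near_cst; near=> y; rewrite /heaviside leNgt; have -> // : y < 0.
by near: y; exact: nbhs_ninfty_lt.
Unshelve. all: by end_near. Qed.

Let heaviside_y : heaviside @ +oo --> (1 : R).
Proof.
apply: cvg_near_cst; near=> y; rewrite /heaviside; have -> // : 0 <= y.
by near: y; exact: nbhs_pinfty_ge.
Unshelve. all: by end_near. Qed.

HB.instance Definition _ :=
  isCumulativeBounded.Build R 0 1 heaviside heaviside_Ny heaviside_y.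

Lemma arrival_law_heaviside (B : set RB) : measurable B ->
  pr (arrival_law heaviside) B = ((0 : R) \in B)%:R.
Proof.
move=> mB; rewrite /pr [X in fine X](_ : _ = \d_(0 : RB) B)//.

(* Agreement on the intervals []a, b]] suffices to identify the Dirac measure. *)
apply: (@lebesgue_stieltjes_measure_unique _ heaviside (\d_(0 : RB))) => // I.
move=> [[a b] _ <-].
rewrite /lebesgue_stieltjes_measure /measure_extension/=.
rewrite measurable_mu_extE/=; last exact: is_ocitv.
have [ab|ba] := leP a b; last first.
  by rewrite set_itv_ge ?wlength0 ?measure0// bnd_simp -leNgt ltW.
rewrite wlength_itv_bnd// diracE; congr EFin.
rewrite /heaviside mem_setE in_itv/=; have [b0|b0] := leP 0 b.
  by rewrite andbT [a < 0]ltNge; case: (0 <= a); rewrite ?subrr ?subr0.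
by rewrite andbF leNgt (le_lt_trans ab b0) subrr.
Qed.

(** With [alpha = gamma] and [mu = 1], waiting and order cost are both [N * gamma / 2] at time 0,
    whereas any later arrival has all [N] others ahead and pays at least [N * gamma]. *)
Lemma equilibrium_heaviside N gamma : (0 < N)%N -> 0 < gamma ->
  symmetric_equilibrium N gamma gamma (@ltr01 R) `[0, +oo[%classic
    heaviside (N%:R * gamma).
Proof.
move=> N_gt0 gamma_gt0; set A := arrival_law heaviside.
have supp0 : arrival_support heaviside = [set 0].
  apply/seteqP; split => t /=.
    apply: contraPP => /eqP t0 /arrival_supportP.
    have t0' : 0 < `|t| by rewrite normr_gt0.
    move=> /(_ _ t0'); rewrite arrival_law_heaviside// memNset ?ltxx//=.
    by rewrite in_itv/=; case: (ler0P t) => _; lra.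
  move=> ->; apply/arrival_supportP => e e0; rewrite arrival_law_heaviside//.
  by rewrite mem_set// /= in_itv/=; apply/andP; split; lra.
have p0 : atom heaviside 0 = 1.
  by rewrite -[LHS]/(pr A [set 0]) arrival_law_heaviside// mem_set.
have m0 : pr A `]-oo, 0[%classic = 0.
  by rewrite arrival_law_heaviside// memNset//= in_itv/= ltxx.
split.
- move=> a b; rewrite supp0; have [ab|ab] := boolP (a <= 0 <= b).
    exists [:: (0, 0)]; rewrite bigcup_seq big_seq1 set_itv1 setIidl//.
    by move=> t /= ->; rewrite in_itv.
  exists [::]; rewrite bigcup_seq big_nil; apply/seteqP; split => // t /= [->].
  by rewrite in_itv/= (negPf ab).
- by rewrite supp0 => t ->; rewrite /= in_itv/= lexx.
- move=> t; rewrite supp0 => ->; rewrite (cost0 _ _ _ _ m0) p0 divr1; lra.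
- move=> t; rewrite /= in_itv/= andbT le_eqVlt => /predU1P[<-|t0].
    by rewrite (cost0 _ _ _ _ m0) p0 divr1; lra.
  apply: le_trans (cost_ge ltr01 N_gt0 gamma_gt0 gamma_gt0 heaviside t).
  have -> : pr A `]-oo, t[%classic = 1.
    by rewrite arrival_law_heaviside// mem_set//= in_itv/=.
  rewrite mulr1 mul1r [gamma * _]mulrC lerDl.
  by rewrite !mulr_ge0 ?pr_ge0 ?invr_ge0// ltW.
Qed.

End PointMass.

Theorem theorem3p1 (R : realType) (N : nat) (alpha gamma mu : R)
    (N_ge2 : (2 <= N)%N) (alpha_gt0 : 0 < alpha) (gamma_gt0 : 0 < gamma)
    (mu_gt0 : 0 < mu) :
  (* arriving before time zero is allowed *)
  (forall (F : cumulativeBounded (0 : R) (1 : R)) (ce : R),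
     symmetric_equilibrium N alpha gamma mu_gt0 setT F ce ->
     exists ta : R,
       [/\ ta < 0,
           arrival_support F = `[ta, +oo[%classic,
           ce = N%:R * gamma &
           ta = - (N%:R * (gamma / alpha))])
  /\
  (* arriving before time zero is not allowed *)
  (forall (F : cumulativeBounded (0 : R) (1 : R)) (ce : R),
     symmetric_equilibrium N alpha gamma mu_gt0 `[0, +oo[%classic F ce ->
     [/\ 0 < atom F 0,
         atom F 0 = (if gamma < alpha / mu
                     then 2 * gamma / (gamma + alpha / mu) else 1),
         ce <= N%:R * gamma &
         atom F 0 < 1 ->
           exists te : R, 0 < te /\ arrival_support F `\ 0 = `[te, +oo[%classic])
  /\
  (* the bound on the cost in the second case is attained *)
  (exists (alpha' mu' : R) (mu'_gt0 : 0 < mu')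
          (F : cumulativeBounded (0 : R) (1 : R)),
     0 < alpha' /\
     symmetric_equilibrium N alpha' gamma mu'_gt0 `[0, +oo[%classic F (N%:R * gamma)).
Proof.
have N_gt0 : (0 < N)%N by exact: ltnW.
split=> [F ce|]; first exact: equilibrium_early.
split=> [F ce|]; first exact: equilibrium_nonneg.
exists gamma, 1, ltr01, heaviside; split=> //.
exact: equilibrium_heaviside.
Qed.
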